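(* Let $A\to B$ be a morphism of finite resolving algebras. Then there exists a resolution $A\to B'\to B$ of $A\to B$ (with $A\to B'$ resolving and $B'\to B$ a quasi-isomorphism, the composite being the given morphism) such that $A\to B'$ is a finite resolving morphism.
   Context: $k$ is a field of characteristic $0$; dg algebras are graded-commutative unital $k$-algebras with differential of degree $+1$. A morphism $A\to B$ of dg algebras is resolving if $B^\natural\cong A^\natural\otimes_kk[x_i]$ for a family of homogeneous $x_i\in B$ of degrees $\le0$ (free graded-commutative algebra); it is finite if such a family can be chosen finite. A finite resolving algebra is a dg algebra $B$ with $k\to B$ a finite resolving morphism. *)

(* Defs.v *)
From HB Require Import structures.
From mathcomp Require Import all_boot all_order all_algebra.
Set Implicit Arguments. Unset Strict Implicit. Unset Printing Implicit Defensive.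
Import Order.TTheory GRing.Theory Num.Theory.
Local Open Scope ring_scope.

(* A (cohomologically) Z-graded, graded-commutative, unital dg algebra over k.
   The carrier is a k-algebra; [dhom n a] means "a is homogeneous of degree n";
   the carrier is the internal direct sum of the subspaces [dhom n]. *)
Record dga (k : fieldType) := DGA {
  dcar :> algType k;
  dhom : int -> dcar -> Prop;
  dd : dcar -> dcar;
  dhom0 : forall n, dhom n 0;
  dhom_lin : forall n (c : k) (a b : dcar), dhom n a -> dhom n b -> dhom n (c *: a + b);
  dhom_span : forall a : dcar, exists (s : seq int) (c : int -> dcar),
      (forall n, dhom n (c n)) /\ a = \sum_(n <- s) c n;
  dhom_direct : forall (s : seq int) (c : int -> dcar), uniq s ->
      (forall n, dhom n (c n)) -> \sum_(n <- s) c n = 0 ->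
      forall n, n \in s -> c n = 0;
  dhom1 : dhom 0 1;
  dhomM : forall m n (a b : dcar), dhom m a -> dhom n b -> dhom (m + n) (a * b);
  dcomm : forall m n (a b : dcar), dhom m a -> dhom n b ->
      a * b = (-1) ^+ (absz (m * n)) * (b * a);
  dd_lin : forall (c : k) (a b : dcar), dd (c *: a + b) = c *: dd a + dd b;
  dd_deg : forall n (a : dcar), dhom n a -> dhom (n + 1) (dd a);
  dd_dd : forall a : dcar, dd (dd a) = 0;
  dd_leibniz : forall m (a b : dcar), dhom m a ->
      dd (a * b) = dd a * b + (-1) ^+ (absz m) * (a * dd b)
}.

Section Defs.
Variable k : fieldType.

Definition dga_morph (A B : dga k) (f : A -> B) : Prop :=
  [/\ forall (c : k) (a b : A), f (c *: a + b) = c *: f a + f b,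
      forall a b : A, f (a * b) = f a * f b,
      f 1 = 1,
      forall n (a : A), dhom n a -> dhom n (f a)
    & forall a : A, f (dd a) = dd (f a)].

Definition quasi_iso (A B : dga k) (f : A -> B) : Prop :=
  (forall n (b : B), dhom n b -> dd b = 0 ->
     exists a : A, [/\ dhom n a, dd a = 0 &
       exists c : B, dhom (n - 1) c /\ f a - b = dd c]) /\
  (forall n (a : A), dhom n a -> dd a = 0 ->
     (exists c : B, dhom (n - 1) c /\ f a = dd c) ->
     exists a' : A, dhom (n - 1) a' /\ a = dd a').

Definition monom (B : dga k) (n : nat) (x : 'I_n -> B) (e : {ffun 'I_n -> nat}) : B :=
  \prod_(i < n) x i ^+ e i.

Definition admissible (n : nat) (dg : 'I_n -> int) (e : {ffun 'I_n -> nat}) : Prop :=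
  forall i, odd (absz (dg i)) -> (e i <= 1)%N.

(* [free_over g x dg]: x_i homogeneous of degree dg_i <= 0, and the canonical
   map R (x) k[x_0..x_{n-1}] -> B, r (x) m |-> g r * m, is bijective, where
   k[x] is the free graded-commutative algebra (basis: admissible monomials).
   I.e. every b is uniquely a finite sum  sum_e g(c_e) * x^e. *)
Definition free_over (R : zmodType) (B : dga k) (g : R -> B) (n : nat)
    (x : 'I_n -> B) (dg : 'I_n -> int) : Prop :=
  [/\ forall i, dhom (dg i) (x i) /\ dg i <= 0,
      forall b : B, exists (s : seq {ffun 'I_n -> nat}) (c : {ffun 'I_n -> nat} -> R),
        (forall e, e \in s -> admissible dg e) /\
        b = \sum_(e <- s) g (c e) * monom x e
    & forall (s : seq {ffun 'I_n -> nat}) (c : {ffun 'I_n -> nat} -> R), uniq s ->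
        (forall e, e \in s -> admissible dg e) ->
        \sum_(e <- s) g (c e) * monom x e = 0 ->
        forall e, e \in s -> c e = 0].

Definition finite_resolving (A B : dga k) (f : A -> B) : Prop :=
  exists (n : nat) (x : 'I_n -> B) (dg : 'I_n -> int), free_over f x dg.

Definition finite_resolving_alg (B : dga k) : Prop :=
  exists (n : nat) (x : 'I_n -> B) (dg : 'I_n -> int),
    free_over (fun c : k => c%:A : B) x dg.

End Defs.

(* Main.v *)
Require Import Defs.
From HB Require Import structures.
From mathcomp Require Import all_boot all_order all_algebra.
From mathcomp Require Import zify.
From Stdlib Require Import IndefiniteDescription.

(* Starting from C = B, contractible pairs (u, v) with dv = u, du = 0 are adjoined to C,
   one for each generator x_i of A, taken by descending degree, so that d x_i only involves
   generators already treated.  Along the way one keeps a retraction h : C -> B with section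
   s and acyclic kernel, and a graded algebra morphism G : A -> C over f.  As
   G(d x_i) - d s(f x_i) is a cycle in ker h, it equals dc with h c = 0, and setting
   G x_i := s(f x_i) + c + u makes G commute with d on x_i.  Since G x_i = u + (an
   element of the previous C), the G x_i, the generators of B and the v_i freely generate
   the final C; hence C is free over A on the generators of B and the v_i. *)

Set Implicit Arguments. Unset Strict Implicit. Unset Printing Implicit Defensive.
Import Order.TTheory GRing.Theory Num.Theory.
Local Open Scope ring_scope.

(** * Linear extension and gradings *)

Section LinearExtension.

(** Killing cohomology classes degree by degree, in the manner of Tate, may require infinitely many
    generators; enlarging B in the style of a mapping cylinder costs one pair per generator of A.
    The lift s(f x_i) + c alone would already commute with d on x_i, but nothing would make C free
    over A. Adding u leaves the differential unchanged, since du = 0, and turns the image of x_i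
    into a new variable. Descending degree works because all degrees are at most 0: a monomial of
    degree deg x_i + 1 cannot contain a generator of degree at most deg x_i. Nonpositivity survives
    because v_i has degree deg x_i - 1. Characteristic 0 enters twice: polynomials are integrated to
    contract a pair whose polynomial variable is v, and odd elements have square zero. *)

Lemma big_group (T E : eqType) (V : nmodType) (key : T -> E) (F : T -> V) l :
  \sum_(p <- l) F p = \sum_(e <- undup (map key l)) \sum_(p <- l | key p == e) F p.
Proof.
under [RHS]eq_bigr do rewrite big_mkcond.
rewrite exchange_big; apply: eq_big_seq => p pl /=.
rewrite -big_mkcond -big_filter.
rewrite (eq_filter (a2 := pred1 (key p))); last by move=> e /=; rewrite eq_sym.
by rewrite filter_pred1_uniq ?undup_uniq ?mem_undup ?map_f// big_seq1.
Qed.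

Lemma semi_additive_sum (U V : zmodType) (F : U -> V) (T : Type) (r : seq T)
    (P : pred T) (x : T -> U) :
  (forall a b, F (a + b) = F a + F b) ->
  F (\sum_(t <- r | P t) x t) = \sum_(t <- r | P t) F (x t).
Proof.
move=> FD; apply: big_morph => //.
by apply: (addrI (F 0)); rewrite -FD !addr0.
Qed.

Variables (k : fieldType) (V W : lmodType k).

(** Lists stand for formal sums, with [sc] absorbing scalars. A list is chosen for each vector, and
    well-definedness is applied to the difference of two lists, one of them negated by [sc (-1)]. *)
Lemma linear_extension (T : eqType) (ok : T -> Prop) (sc : k -> T -> T)
    (al : T -> V) (be : T -> W) :
  (forall c t, ok t -> ok (sc c t)) ->
  (forall c t, al (sc c t) = c *: al t) ->
  (forall c t, be (sc c t) = c *: be t) ->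
  (forall v, exists l, (forall t, t \in l -> ok t) /\ v = \sum_(t <- l) al t) ->
  (forall l, (forall t, t \in l -> ok t) ->
     \sum_(t <- l) al t = 0 -> \sum_(t <- l) be t = 0) ->
  exists F : V -> W, (forall c a b, F (c *: a + b) = c *: F a + F b) /\
    forall t, ok t -> F (al t) = be t.
Proof.
move=> oksc alsc besc span wd.
have [L HL] := functional_choice _ span.
pose F v := \sum_(t <- L v) be t.
have key l : (forall t, t \in l -> ok t) ->
    F (\sum_(t <- l) al t) = \sum_(t <- l) be t.
  move=> okl; have [okL eL] := HL (\sum_(t <- l) al t).
  have := wd (L (\sum_(t <- l) al t) ++ map (sc (-1)) l).
  rewrite !big_cat /= !big_map -eL.
  rewrite (eq_bigr _ (fun t _ => alsc (-1) t)) (eq_bigr _ (fun t _ => besc (-1) t)).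
  rewrite -!scaler_sumr !scaleN1r subrr => H; apply/eqP; rewrite -subr_eq0; apply/eqP/H => // t.
  by rewrite mem_cat => /orP [/okL//|/mapP [u ul ->]]; apply/oksc/okl.
exists F; split=> [c a b|t okt]; last first.
  by have := key [:: t]; rewrite !big_seq1; apply=> u; rewrite inE => /eqP->.
have [oka ea] := HL a; have [okb eb] := HL b.
have := key (map (sc c) (L a) ++ L b); rewrite !big_cat /= !big_map.
rewrite (eq_bigr _ (fun t _ => alsc c t)) -scaler_sumr -ea -eb => ->.
  by rewrite (eq_bigr _ (fun t _ => besc c t)) -scaler_sumr.
by move=> t; rewrite mem_cat => /orP [/mapP [u ul ->]|/okb//]; apply/oksc/oka.
Qed.

End LinearExtension.

Section Grading.
Variable k : fieldType.

Lemma oddzD (m n : int) : odd (absz (m + n)) = odd (absz m) (+) odd (absz n).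
Proof. by lia. Qed.

Lemma oddzM (m n : int) : odd (absz (m * n)) = odd (absz m) && odd (absz n).
Proof. by rewrite abszM oddM. Qed.

Implicit Types C : dga k.

Lemma dhomZ C n c (a : C) : dhom n a -> dhom n (c *: a).
Proof. by move=> ha; rewrite -[c *: a]addr0; apply/dhom_lin/dhom0. Qed.

Lemma dhomD C n (a b : C) : dhom n a -> dhom n b -> dhom n (a + b).
Proof. by move=> ha hb; rewrite -[a]scale1r; apply: dhom_lin. Qed.

Lemma dhomN C n (a : C) : dhom n a -> dhom n (- a).
Proof. by rewrite -scaleN1r; apply: dhomZ. Qed.

Lemma dhomB C n (a b : C) : dhom n a -> dhom n b -> dhom n (a - b).
Proof. by move=> ha hb; apply/dhomD/dhomN. Qed.

Lemma dhom_sum C n (T : Type) (r : seq T) (P : pred T) (F : T -> C) :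
  (forall t, P t -> dhom n (F t)) -> dhom n (\sum_(t <- r | P t) F t).
Proof. by move=> H; elim/big_ind: _ => //; [apply: dhom0 | move=> *; apply: dhomD]. Qed.

Lemma dhomX C n (a : C) i : dhom n a -> dhom (n *+ i) (a ^+ i).
Proof.
move=> ha; elim: i => [|i IH]; first exact: dhom1.
by rewrite exprS mulrS; apply: dhomM.
Qed.

Lemma dhom_sign C n (a : C) i : dhom n a -> dhom n ((-1) ^+ i * a).
Proof. by move=> ha; rewrite -signr_odd mulr_sign; case: odd => //; apply: dhomN. Qed.

Lemma graded_comm C m n (a b : C) : dhom m a -> dhom n b ->
  a * b = (-1) ^+ (odd (absz m) && odd (absz n)) * (b * a).
Proof. by move=> ha hb; rewrite (dcomm ha hb) -signr_odd oddzM. Qed.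

Lemma graded_span C (a : C) : exists l : seq (int * C),
  (forall p, p \in l -> dhom p.1 p.2) /\ a = \sum_(p <- l) p.2.
Proof.
have [s [c [hc ->]]] := dhom_span a.
exists [seq (n, c n) | n <- s]; rewrite big_map; split=> // p.
by case/mapP=> n _ ->.
Qed.

Lemma graded_ind C (P : C -> Prop) :
  (forall a b, P a -> P b -> P (a + b)) -> (forall n a, dhom n a -> P a) ->
  forall a, P a.
Proof.
move=> PD Ph a; have [l [hl ->]] := graded_span a.
rewrite big_seq; elim/big_ind: _ => // [|p /hl]; last exact: Ph.
exact/(Ph 0)/dhom0.
Qed.

Lemma dd_linear C : linear (@dd k C).
Proof. exact: dd_lin. Qed.
HB.instance Definition _ C := GRing.isLinear.Build k C C _ (@dd k C) (@dd_linear C).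

(** The grading is given by predicates, so no component maps come with it. Directness makes an
    operator that is scalar on each component well defined; the parity involution and the
    projections are the instances used. *)
Lemma weight_operator C (phi : int -> k) : exists F : C -> C,
  (forall c a b, F (c *: a + b) = c *: F a + F b) /\
  forall n a, dhom n a -> F a = phi n *: a.
Proof.
have [|||||F [Flin Fh]] := @linear_extension k C C (int * C)%type
    (fun p => dhom p.1 p.2) (fun c p => (p.1, c *: p.2)) snd (fun p => phi p.1 *: p.2).
- by move=> c [n a] /=; apply: dhomZ.
- by [].
- by move=> c [n a] /=; rewrite !scalerA mulrC.
- exact: graded_span.
- move=> l hl; rewrite (big_group fst) (big_group fst (fun p => phi p.1 *: p.2)) => l0.
  rewrite big_seq big1 // => n nl.
  rewrite (eq_bigr (fun p => phi n *: p.2)); last by move=> p /eqP->.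
  rewrite -scaler_sumr.
  have -> := dhom_direct (undup_uniq _) _ l0 nl; first by rewrite scaler0.
  move=> m; rewrite big_seq_cond.
  by apply: dhom_sum => p /andP[/hl hp /eqP <-].
by exists F; split=> // n a ha; apply: (Fh (n, a)).
Qed.

Lemma sign_exists C : exists F : C -> C,
  (forall c a b, F (c *: a + b) = c *: F a + F b) /\
  forall n a, dhom n a -> F a = (-1) ^+ (odd (absz n)) * a.
Proof.
have [F [Fl Fh]] := weight_operator C (fun n => (-1) ^+ (odd (absz n))).
exists F; split=> // n a ha; rewrite (Fh n a ha) mulr_sign.
by case: odd; rewrite ?expr0 ?expr1 ?scaleN1r ?scale1r.
Qed.

(** The parity involution as a total linear map: it turns the Leibniz rule and the signs of the
    extension into identities without degree hypotheses. *)
Definition sgn C : C -> C :=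
  proj1_sig (constructive_indefinite_description _ (sign_exists C)).

Lemma sgn_linear C : linear (@sgn C).
Proof. by rewrite /sgn; case: constructive_indefinite_description => F []. Qed.
HB.instance Definition _ C := GRing.isLinear.Build k C C _ (@sgn C) (@sgn_linear C).

Lemma sgn_hom C n (a : C) : dhom n a -> sgn a = (-1) ^+ (odd (absz n)) * a.
Proof.
move: n a; rewrite /sgn.
by case: constructive_indefinite_description => F [].
Qed.

Lemma sgn_monoid_morphism C : monoid_morphism (@sgn C).
Proof.
split=> [|a b]; first by rewrite (sgn_hom (dhom1 C)) expr0 mul1r.
move: a; apply: graded_ind => [a a' IH IH'|m a ha];
  first by rewrite mulrDl !raddfD /= IH IH' mulrDl.
move: b; apply: graded_ind => [b b' IH IH'|n b hb];
  first by rewrite mulrDr !raddfD /= IH IH' mulrDr.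
rewrite (sgn_hom (dhomM ha hb)) (sgn_hom ha) (sgn_hom hb) oddzD !mulr_sign.
by do 2!case: odd; rewrite /= ?mulrN ?mulNr ?opprK.
Qed.
HB.instance Definition _ C :=
  GRing.isMonoidMorphism.Build C C (@sgn C) (@sgn_monoid_morphism C).

Lemma dhom_sgn C n (a : C) : dhom n a -> dhom n (sgn a).
Proof. by move=> ha; rewrite (sgn_hom ha); apply: dhom_sign. Qed.

Lemma sgnK C : involutive (@sgn C).
Proof.
apply: graded_ind => [a b IH IH'|n a ha]; first by rewrite !raddfD /= IH IH'.
rewrite (sgn_hom (dhom_sgn ha)) (sgn_hom ha) !mulr_sign.
by case: odd; rewrite ?opprK.
Qed.

Lemma dd_sgn C (a : C) : dd (sgn a) = - sgn (dd a).
Proof.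
move: a; apply: graded_ind => [a b IH IH'|n a ha]; first by rewrite !raddfD /= IH IH'.
rewrite (sgn_hom (dd_deg ha)) (sgn_hom ha) oddzD !mulr_sign.
by case: odd; rewrite /= ?raddfN ?opprK.
Qed.

Lemma dd_mul C (a b : C) : dd (a * b) = dd a * b + sgn a * dd b.
Proof.
move: a; apply: graded_ind => [a a' IH IH'|n a ha].
  by rewrite mulrDl !raddfD /= IH IH' !mulrDl addrACA.
by rewrite (dd_leibniz b ha) -signr_odd (sgn_hom ha) mulrA.
Qed.

Lemma dd1 C : dd (1 : C) = 0.
Proof.
have := dd_mul (1 : C) 1; rewrite !mul1r mulr1 rmorph1 mul1r -[X in X = _]addr0.
by move/addrI.
Qed.

Lemma homogeneous_part C (n : int) : exists F : C -> C,
  (forall c a b, F (c *: a + b) = c *: F a + F b) /\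
  forall m a, dhom m a -> F a = if m == n then a else 0.
Proof.
have [F [Fl Fh]] := weight_operator C (fun m => (m == n)%:R).
exists F; split=> // m a ha; rewrite (Fh m a ha).
by case: eqP; rewrite ?scale1r ?scale0r.
Qed.

End Grading.

(** * Adjoining a contractible pair of generators *)

(* [(P, Q)] stands for P + Q t, where the polynomial variable is even and t is an odd
   variable, so that t a = sgn(a) t. *)
Definition ext (k : fieldType) (C : dga k) : Type := ({poly C} * {poly C})%type.

Section Ext.
Variables (k : fieldType) (C : dga k).
Implicit Types (x y z : ext C) (P Q : {poly C}).

HB.instance Definition _ := GRing.Zmodule.copy (ext C) ({poly C} * {poly C})%type.

Definition sgp : {poly C} -> {poly C} := map_poly (@sgn k C).
Definition ddp : {poly C} -> {poly C} := map_poly (@dd k C).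

HB.instance Definition _ := GRing.RMorphism.copy sgp (map_poly (@sgn k C)).
HB.instance Definition _ := GRing.Additive.copy ddp (map_poly (@dd k C)).

Lemma coef_sgp P i : (sgp P)`_i = sgn P`_i.
Proof. exact: coef_map. Qed.

Lemma coef_ddp P i : (ddp P)`_i = dd P`_i.
Proof. exact: coef_map. Qed.

Lemma sgpK : involutive sgp.
Proof. by move=> P; apply/polyP=> i; rewrite !coef_sgp sgnK. Qed.

Lemma ddp_sgp P : ddp (sgp P) = - sgp (ddp P).
Proof. by apply/polyP=> i; rewrite coefN coef_ddp !coef_sgp coef_ddp dd_sgn. Qed.

Lemma ddp_ddp P : ddp (ddp P) = 0.
Proof. by apply/polyP=> i; rewrite !coef_ddp dd_dd coef0. Qed.

Lemma ddp_mul P Q : ddp (P * Q) = ddp P * Q + sgp P * ddp Q.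
Proof.
apply/polyP=> i; rewrite coefD !(coef_ddp, coefM) raddf_sum -big_split /=.
by apply: eq_bigr => j _; rewrite dd_mul !(coef_ddp, coef_sgp).
Qed.

Definition ext_mul x y : ext C := (x.1 * y.1, x.1 * y.2 + x.2 * sgp y.1).

Lemma ext_mulA : associative ext_mul.
Proof.
move=> x y z; congr pair; rewrite /= ?mulrA //.
by rewrite rmorphM !mulrDr !mulrDl !mulrA addrA.
Qed.

Lemma ext_mul1 : left_id ((1, 0) : ext C) ext_mul.
Proof. by move=> [P Q]; rewrite /ext_mul /= !mul1r mul0r addr0. Qed.

Lemma ext_1mul : right_id ((1, 0) : ext C) ext_mul.
Proof. by move=> [P Q]; rewrite /ext_mul /= rmorph1 !mulr1 mulr0 add0r. Qed.

Lemma ext_mulDl : left_distributive ext_mul +%R.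
Proof.
move=> x y z; congr pair; rewrite /= ?mulrDl //.
by rewrite [LHS]addrACA.
Qed.

Lemma ext_mulDr : right_distributive ext_mul +%R.
Proof.
move=> x y z; congr pair; rewrite /= ?mulrDr //.
by rewrite raddfD /= mulrDr [LHS]addrACA.
Qed.

Lemma ext_1_neq0 : ((1, 0) : ext C) != 0.
Proof. by apply/eqP=> -[] /eqP; rewrite oner_eq0. Qed.

HB.instance Definition _ := GRing.Zmodule_isNzRing.Build (ext C)
  ext_mulA ext_mul1 ext_1mul ext_mulDl ext_mulDr ext_1_neq0.

(** Polynomials over [C] are scaled by elements of [C], so k acts through [c%:A]. *)
Definition ext_scale (c : k) x : ext C := (c%:A *: x.1, c%:A *: x.2).

Lemma ext_scalerA a b x : ext_scale a (ext_scale b x) = ext_scale (a * b) x.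
Proof. by rewrite /ext_scale /= !scalerA -scalerAl mul1r scalerA. Qed.

Lemma ext_scale1r : left_id 1 ext_scale.
Proof. by move=> [P Q]; rewrite /ext_scale /= !scale1r. Qed.

Lemma ext_scalerDr : right_distributive ext_scale +%R.
Proof. by move=> a x y; rewrite /ext_scale /= !scalerDr. Qed.

Lemma ext_scalerDl x : {morph ext_scale^~ x : a b / a + b}.
Proof. by move=> a b; rewrite /ext_scale /= !scalerDl. Qed.

HB.instance Definition _ := GRing.Zmodule_isLmodule.Build k (ext C)
  ext_scalerA ext_scale1r ext_scalerDr ext_scalerDl.

Lemma ext_scalerAl (a : k) x y : a *: (x * y) = (a *: x) * y.
Proof. by congr pair; rewrite /= ?scalerDr -!scalerAl. Qed.

HB.instance Definition _ := GRing.Lmodule_isLalgebra.Build k (ext C) ext_scalerAl.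

Lemma scalerA_central (a : k) P Q : a%:A *: (P * Q) = P * (a%:A *: Q).
Proof.
apply/polyP=> i; rewrite coefZ !coefM mulr_sumr; apply: eq_bigr => j _.
by rewrite coefZ -!scalerAl !mul1r scalerAr.
Qed.

Lemma ext_scalerAr (a : k) x y : a *: (x * y) = x * (a *: y).
Proof.
congr pair; rewrite /= ?scalerDr !scalerA_central //; congr (_ + _ * _).
apply/polyP=> i; rewrite coefZ !coef_sgp coefZ rmorphM /= linearZ /= rmorph1.
by [].
Qed.

HB.instance Definition _ := GRing.Lalgebra_isAlgebra.Build k (ext C) ext_scalerAr.

Lemma ext_mulE x y : x * y = (x.1 * y.1, x.1 * y.2 + x.2 * sgp y.1) :> ext C.
Proof. by []. Qed.

Lemma ext_addE x y : x + y = (x.1 + y.1, x.2 + y.2) :> ext C.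
Proof. by []. Qed.

Lemma ext_scaleE (c : k) x : c *: x = (c%:A *: x.1, c%:A *: x.2) :> ext C.
Proof. by []. Qed.

Lemma ext_oppE x : - x = (- x.1, - x.2) :> ext C.
Proof. by []. Qed.

Lemma ext_sumE (T : Type) (r : seq T) (F : T -> ext C) :
  \sum_(t <- r) F t = (\sum_(t <- r) (F t).1, \sum_(t <- r) (F t).2).
Proof. by elim: r => [|t r IH]; rewrite ?big_nil // !big_cons IH. Qed.

End Ext.

(** * The dg structure on the extension *)

Section ExtDga.
Variables (k : fieldType) (C : dga k).
Implicit Types (x y z : ext C) (P Q : {poly C}).

Lemma dhom_eq (D : dga k) (m n : int) (a : D) : dhom m a -> m = n -> dhom n a.
Proof. by move=> ha <-. Qed.

(** Signs depend only on degrees mod 2. As the polynomial variable is even, the coefficients of a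
    homogeneous element share one parity although their degrees vary with [i]. *)
Definition parity (s : bool) P := forall i, exists m, odd (absz m) = s /\ dhom m P`_i.

Lemma parity_sgp s P : parity s P -> sgp P = (-1) ^+ s * P.
Proof.
move=> hP; apply/polyP=> i; rewrite coef_sgp.
have [m [<- hm]] := hP i; rewrite (sgn_hom hm) !mulr_sign.
by case: odd; rewrite ?coefN.
Qed.

Lemma parity_comm s t P Q : parity s P -> parity t Q ->
  P * Q = (-1) ^+ (s && t) * (Q * P).
Proof.
move=> hP hQ; apply/polyP=> i; rewrite mulr_sign.
suff -> : (P * Q)`_i = (-1) ^+ (s && t) * (Q * P)`_i.
  by rewrite mulr_sign; case: ifP; rewrite ?coefN.
rewrite coefM coefMr mulr_sumr; apply: eq_bigr => j _.
have [m [<- hm]] := hP j; have [n [<- hn]] := hQ (i - j)%N.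
exact: graded_comm.
Qed.

(* [p] is the degree of the polynomial variable, [q] that of the exterior one. *)
Variables (b : bool) (p : int).
Hypothesis p_even : ~~ odd (absz p).
Let q : int := if b then p - 1 else p + 1.

Definition ext_hom (m : int) x : Prop :=
  forall i, dhom (m - p *+ i) x.1`_i /\ dhom (m - q - p *+ i) x.2`_i.

(* [b] tells that the differential maps the exterior variable to the polynomial one;
   otherwise it maps the polynomial variable to the exterior one. *)
Definition ext_d x : ext C :=
  (ddp x.1 + (if b then sgp x.2 * 'X else 0),
   ddp x.2 + (if b then 0 else (sgp x.1)^`())).

Let odd_pn i : odd (absz (p *+ i)) = false.
Proof. by elim: i => // i IH; rewrite mulrS oddzD IH (negbTE p_even). Qed.

Let q_odd : odd (absz q).
Proof. by rewrite /q; case: b; lia. Qed.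

Lemma ext_hom_parity m x : ext_hom m x ->
  parity (odd (absz m)) x.1 /\ parity (~~ odd (absz m)) x.2.
Proof.
move=> hx; split=> i; have [h1 h2] := hx i.
  by exists (m - p *+ i); split=> //; rewrite oddzD abszN odd_pn addbF.
exists (m - q - p *+ i); split=> //.
by rewrite !oddzD !abszN odd_pn addbF q_odd addbT.
Qed.

Lemma ext_hom0 n : ext_hom n 0.
Proof. by move=> i /=; rewrite !coef0; split; apply: dhom0. Qed.

Lemma ext_hom_lin n (c : k) x y : ext_hom n x -> ext_hom n y -> ext_hom n (c *: x + y).
Proof.
move=> hx hy i; have [h1 h2] := hx i; have [h3 h4] := hy i.
by rewrite ext_addE ext_scaleE /= !coefD !coefZ -!scalerAl !mul1r; split; apply: dhom_lin.
Qed.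

Lemma ext_span x : exists (s : seq int) (c : int -> ext C),
  (forall n, ext_hom n (c n)) /\ x = \sum_(n <- s) c n.
Proof.
(* Lists of homogeneous terms may repeat degrees and are closed under concatenation; terms of equal
   degree are merged only here. *)
suff [l [hl ->]] : exists l : seq (int * ext C),
    (forall t, t \in l -> ext_hom t.1 t.2) /\ x = \sum_(t <- l) t.2.
  exists (undup (map fst l)), (fun n => \sum_(t <- l | t.1 == n) t.2).
  split; last exact: big_group.
  move=> n; rewrite big_seq_cond; elim/big_ind: _; first exact: ext_hom0.
    by move=> y z hy hz; rewrite -[y]scale1r; apply: ext_hom_lin.
  by move=> t /andP[/hl ht /eqP <-].
pose good y := exists l : seq (int * ext C),
    (forall t, t \in l -> ext_hom t.1 t.2) /\ y = \sum_(t <- l) t.2.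
have goodD y z : good y -> good z -> good (y + z).
  move=> [l [hl ->]] [l' [hl' ->]]; exists (l ++ l'); rewrite big_cat; split=> // t.
  by rewrite mem_cat => /orP[/hl|/hl'].
have good0 : good 0 by exists [::]; rewrite big_nil.
have goodh n y : ext_hom n y -> good y.
  by move=> hy; exists [:: (n, y)]; rewrite big_seq1; split=> // t; rewrite inE => /eqP ->.
have good1 (a : C) i : good (a *: 'X^i, 0).
  move: a; apply: graded_ind => [a a' h h'|n a ha].
    by have := goodD _ _ h h'; rewrite ext_addE /= addr0 -scalerDl.
  apply: (goodh (n + p *+ i)) => j /=; rewrite coefZ coefXn coef0.
  split; last exact: dhom0.
  by case: eqP => [->|_]; rewrite ?mulr1 ?mulr0 ?addrK //; apply: dhom0.
have good2 (a : C) i : good (0, a *: 'X^i).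
  move: a; apply: graded_ind => [a a' h h'|n a ha].
    by have := goodD _ _ h h'; rewrite ext_addE /= addr0 -scalerDl.
  apply: (goodh (n + p *+ i + q)) => j /=; rewrite coefZ coefXn coef0.
  split; first exact: dhom0.
  by case: eqP => [->|_]; rewrite ?mulr1 ?mulr0 ?addrK //; apply: dhom0.
have -> : x = \sum_(i < size x.1) (x.1`_i *: 'X^i, 0) + \sum_(i < size x.2) (0, x.2`_i *: 'X^i).
  rewrite !ext_sumE ext_addE. rewrite /= !big1_eq addr0 add0r -!(poly_def _ (fun i => _`_i)) !coefK.
  by case: x.
apply: (goodD); apply: (big_ind good good0 goodD) => i _; [exact: good1|exact: good2].
Qed.

Lemma ext_direct (s : seq int) (c : int -> ext C) : uniq s ->
  (forall n, ext_hom n (c n)) -> \sum_(n <- s) c n = 0 ->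
  forall n, n \in s -> c n = 0.
Proof.
move=> us hc; rewrite ext_sumE => -[s1 s2] n ns.
(* The coefficients at a monomial of degree r are homogeneous of degree n - r, so directness in [C]
   is applied to the degrees shifted by r. *)
have shift (r : int) (e : int -> C) : (forall n, dhom (n - r) (e n)) ->
    \sum_(n <- s) e n = 0 -> e n = 0.
  move=> he e0; have := @dhom_direct k C [seq m - r | m <- s] (fun m => e (m + r)).
  rewrite map_inj_uniq; last exact: addIr.
  move=> /(_ us) H; have := H _ _ (n - r); rewrite subrK; apply.
  - by move=> m; have := he (m + r); rewrite addrK.
  - by rewrite big_map -[RHS]e0; apply: eq_bigr => m _; rewrite subrK.
  - by apply/mapP; exists n.
suff [h1 h2] : (c n).1 = 0 /\ (c n).2 = 0 by case: (c n) h1 h2 => P Q /= -> ->.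
split; apply/polyP=> i; rewrite coef0.
  apply: (shift (p *+ i) (fun n => (c n).1`_i)).
    by move=> m; have [] := hc m i.
  by rewrite -coef_sum s1 coef0.
apply: (shift (q + p *+ i) (fun n => (c n).2`_i)).
  by move=> m; have [_ h] := hc m i; rewrite opprD addrA.
by rewrite -coef_sum s2 coef0.
Qed.

Lemma ext_hom1 : ext_hom 0 1.
Proof.
move=> i; rewrite /= coef0 coef1; split; last exact: dhom0.
by case: i => [|i]; [rewrite subr0; apply: dhom1 | apply: dhom0].
Qed.

Lemma ext_homM m n x y : ext_hom m x -> ext_hom n y -> ext_hom (m + n) (x * y).
Proof.
move=> hx hy i; rewrite ext_mulE /=.
have pE (j : 'I_i.+1) : p *+ i = p *+ j + p *+ (i - j).
  by rewrite -mulrnDr subnKC // -ltnS.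
split; first rewrite coefM; last rewrite coefD !coefM.
  apply: dhom_sum => j _; have [h1 _] := hx j; have [h2 _] := hy (i - j)%N.
  by apply: dhom_eq (dhomM h1 h2) _; rewrite (pE j); lia.
apply: dhomD; apply: dhom_sum => j _.
  have [h1 _] := hx j; have [_ h2] := hy (i - j)%N.
  by apply: dhom_eq (dhomM h1 h2) _; rewrite (pE j); lia.
have [_ h1] := hx j; have [h2 _] := hy (i - j)%N; rewrite coef_sgp.
by apply: dhom_eq (dhomM h1 (dhom_sgn h2)) _; rewrite (pE j); lia.
Qed.

Lemma ext_comm m n x y : ext_hom m x -> ext_hom n y ->
  x * y = (-1) ^+ (absz (m * n)) * (y * x).
Proof.
move=> /ext_hom_parity[x1 x2] /ext_hom_parity[y1 y2].
rewrite -signr_odd oddzM mulr_sign !ext_mulE (parity_sgp x1) (parity_sgp y1) !mulr_sign.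
rewrite (parity_comm x1 y1) (parity_comm x1 y2).
move: (odd (absz m)) (odd (absz n)) x1 x2 y1 y2 => s t x1 x2 y1 y2.
have := parity_comm x2 y1; rewrite !mulr_sign.
by case: s {x1 x2}; case: t {y1 y2}; rewrite /= ?mulrN => -> /=;
  rewrite ?ext_oppE /= ?opprD ?opprK 1?addrC.
Qed.

Lemma ext_d_lin (c : k) x y : ext_d (c *: x + y) = c *: ext_d x + ext_d y.
Proof.
have ddpZ P : ddp (c%:A *: P) = c%:A *: ddp P.
  by apply/polyP=> i; rewrite coefZ !coef_ddp coefZ -!scalerAl !mul1r linearZ.
have sgpZ P : sgp (c%:A *: P) = c%:A *: sgp P.
  by apply/polyP=> i; rewrite coefZ !coef_sgp coefZ -!scalerAl !mul1r linearZ.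
rewrite /ext_d !ext_addE !ext_scaleE /= !raddfD /= !ddpZ !sgpZ.
case: b; rewrite !(scaler0, addr0) ?mulrDl ?derivD ?derivZ ?scalerDr ?scalerAl;
  congr pair; rewrite ?scaler0 ?addr0 // addrACA // -scalerAl.
Qed.

Lemma ext_d_deg n x : ext_hom n x -> ext_hom (n + 1) (ext_d x).
Proof.
move=> hx i; rewrite /= !coefD !coef_ddp; have [/dd_deg h1 /dd_deg h2] := hx i.
split; apply: dhomD; [by apply: dhom_eq h1 _; lia| |by apply: dhom_eq h2 _; lia|];
  move: hx; rewrite /ext_hom /q; case: b => hx; rewrite ?coef0; try exact: dhom0.
  rewrite coefMX; case: i {h1 h2} => [|i]; first exact: dhom0.
  have [_ h] := hx i; rewrite /= coef_sgp mulrS.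
  by apply: dhom_eq (dhom_sgn h) _; lia.
rewrite coef_deriv coef_sgp -scaler_nat; apply: dhomZ.
have [h _] := hx i.+1; apply: dhom_eq (dhom_sgn h) _.
by rewrite mulrS; lia.
Qed.

Lemma ext_d_d x : ext_d (ext_d x) = 0.
Proof.
have ddpMX P : ddp (P * 'X) = ddp P * 'X.
  by apply/polyP=> -[|i]; rewrite coef_ddp !coefMX /= ?coef_ddp ?raddf0.
have ddp_deriv P : ddp P^`() = (ddp P)^`().
  by apply/polyP=> i; rewrite coef_ddp !coef_deriv raddfMn coef_ddp.
rewrite /ext_d; case: b; rewrite /= !addr0 !raddfD /= !ddp_ddp add0r; congr pair.
  by rewrite ddpMX -mulrDl ddp_sgp addNr mul0r.
by rewrite ddp_deriv -derivD ddp_sgp addNr deriv0.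
Qed.

(** The pair [(sgp x.1, - sgp x.2)] is the parity involution of the extension: the polynomial
    variable is even, t is odd. *)
Lemma ext_d_mul x y :
  ext_d (x * y) = ext_d x * y + ((sgp x.1, - sgp x.2) : ext C) * ext_d y.
Proof.
rewrite !ext_mulE /ext_d /= ext_addE /= !raddfD /= !ddp_mul !rmorphM /= ddp_sgp sgpK.
case: b; rewrite ?addr0; congr pair.
- rewrite !mulrDl !mulrDr -!mulrA (commr_polyX y.1).
  by rewrite [sgp x.1 * (sgp y.2 * 'X) + _]addrC addrACA.
- rewrite rmorphM /= [sgp 'X](map_polyX (@sgn k C)) sgpK mulrDl mulrDr !mulNr mulrN.
  rewrite -[sgp x.2 * 'X * _]mulrA -(commr_polyX y.2).
  by rewrite [RHS](AC ((2*1)*(1*2)) (((1*4)*(3*5))*(2*6))) /= subrr addr0.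
- rewrite derivM raddf0 addr0 mulrDl mulrDr mulrN mulNr.
  by rewrite [LHS](AC (2*2*2) (1*(3*5)*((2*6)*4))).
Qed.

Lemma ext_leibniz m x y : ext_hom m x ->
  ext_d (x * y) = ext_d x * y + (-1) ^+ (absz m) * (x * ext_d y).
Proof.
move=> /ext_hom_parity[h1 h2]; rewrite -[in RHS]signr_odd ext_d_mul.
rewrite (parity_sgp h1) (parity_sgp h2) !mulr_sign; congr (_ + _).
by case: x {h1 h2} => P Q; case: (odd _); rewrite /= ?opprK -?mulNr.
Qed.

Definition ext_dga : dga k :=
  @DGA k (ext C) ext_hom ext_d ext_hom0 ext_hom_lin ext_span ext_direct ext_hom1
    ext_homM ext_comm ext_d_lin ext_d_deg ext_d_d ext_leibniz.

End ExtDga.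

(** * Bases through coordinate functionals *)

Section Bases.
Variables (E : eqType) (R V : zmodType) (ok : E -> Prop) (act : R -> E -> V).

Definition lspan (v : V) := exists l : seq (R * E),
  (forall p, p \in l -> ok p.2) /\ v = \sum_(p <- l) act p.1 p.2.

(* The functional [co] is the coordinate of index [e]: its existence for every
   admissible [e] expresses the linear independence of the family. *)
Definition lbasis := (forall v, lspan v) /\
  forall e, ok e -> exists co : V -> R,
    (forall a b, co (a + b) = co a + co b) /\
    forall r e', ok e' -> co (act r e') = if e' == e then r else 0.

Lemma lspan_gen r e : ok e -> lspan (act r e).
Proof.
by move=> oke; exists [:: (r, e)]; rewrite big_seq1; split=> // p; rewrite inE => /eqP->.
Qed.

Lemma lspan_add v w : lspan v -> lspan w -> lspan (v + w).
Proof.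
move=> [l [hl ->]] [l' [hl' ->]]; exists (l ++ l'); rewrite big_cat; split=> // p.
by rewrite mem_cat => /orP[/hl|/hl'].
Qed.

Lemma lspan0 : lspan 0.
Proof. by exists [::]; rewrite big_nil. Qed.

Lemma lspan_sum (T : Type) (r : seq T) (F : T -> V) :
  (forall t, lspan (F t)) -> lspan (\sum_(t <- r) F t).
Proof. by move=> H; apply: (big_ind lspan lspan0 lspan_add). Qed.

End Bases.

(** The primitive may lie outside the kernel; given a dg section s of h, a' - s(h a') is a primitive
    inside it. *)
Definition ker_acyclic (k : fieldType) (C B : dga k) (h : C -> B) : Prop :=
  forall n (a : C), dhom n a -> dd a = 0 -> h a = 0 ->
    exists a', dhom (n - 1) a' /\ dd a' = a.

(** * Translating the variable of a polynomial over a noncommutative ring *)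

Section Shift.
Variable R : nzRingType.

(** Over a noncommutative ring substitution is not multiplicative in general; centrality of d makes
    it so for this factor. *)
Lemma comp_poly_shift (d : R) (P : {poly R}) : (forall r, r * d = d * r) ->
  (P * ('X + d%:P)) \Po ('X - d%:P) = (P \Po ('X - d%:P)) * 'X.
Proof.
move=> dC; rewrite mulrDr comp_polyD -{1}[P * 'X]addr0 -polyC0 comp_poly_MXaddC addr0.
have -> : P * d%:P = d *: P by apply/polyP=> i; rewrite coefMC coefZ dC.
rewrite comp_polyZ mulrBr -addrA.
suff -> : (P \Po ('X - d%:P)) * d%:P = d *: (P \Po ('X - d%:P)) by rewrite addNr addr0.
by apply/polyP=> i; rewrite coefMC coefZ dC.
Qed.

Lemma comp_poly_shiftX (d : R) a c : (forall r, r * d = d * r) ->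
  (c *: ('X + d%:P) ^+ a) \Po ('X - d%:P) = c *: 'X^a.
Proof.
move=> dC; rewrite comp_polyZ; congr (_ *: _).
by elim: a => [|a IH]; rewrite ?comp_polyC // !exprSr comp_poly_shift // IH.
Qed.

Lemma comp_poly_shiftK (d : R) P : (forall r, r * d = d * r) ->
  (P \Po ('X - d%:P)) \Po ('X + d%:P) = P.
Proof.
move=> dC; elim/poly_ind: P => [|P c IH]; first by rewrite !comp_poly0.
rewrite comp_poly_MXaddC comp_polyD comp_polyC -[in RHS]IH; congr (_ + _).
have := @comp_poly_shift (- d) (P \Po ('X - d%:P)); rewrite polyCN opprK; apply.
by move=> r; rewrite mulrN mulNr dC.
Qed.

End Shift.

Section ExtBases.
Variables (k : fieldType) (C : dga k).

Lemma ext_expE (P : {poly C}) a : ((P, 0) : ext C) ^+ a = (P ^+ a, 0).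
Proof.
elim: a => [|a IH]; first by rewrite !expr0.
by rewrite !exprS IH ext_mulE /= mulr0 mul0r addr0.
Qed.

(** The powers are those of c0 + u rather than u, because c0 + u will be the image of a generator of
    A. *)
Let act (c0 : C) (u v : ext C) (c : C) (ab : nat * nat) : ext C :=
  ((c%:P, 0) : ext C) * ((((c0%:P, 0) : ext C) + u) ^+ ab.1 * v ^+ ab.2).

(** Since c0 is central, the substitution X := X - c0 carries the powers of X + c0 to those of X,
    and coordinates are coefficients after this substitution. *)
Lemma ext_even_basis (c0 : C) (ok : nat * nat -> Prop) :
  (forall r, r * c0 = c0 * r) -> (forall ab, ok ab <-> (ab.2 <= 1)%N) ->
  lbasis ok (act c0 ('X, 0) (0, 1)).
Proof.
move=> c0C okP.
have actE c ab : ok ab -> act c0 ('X, 0) (0, 1) c ab =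
    let P := c *: ('X + c0%:P) ^+ ab.1 in if ab.2 == 0%N then (P, 0) else (0, P).
  case: ab => a j /okP /= j1; rewrite /act ext_addE /= addr0 ext_expE addrC.
  case: j j1 => [|[|//]] _; rewrite ?expr0 ?expr1 ?mulr1 !ext_mulE /= ?mulr0 ?mul0r ?addr0.
    by rewrite mul_polyC.
  by rewrite mulr1 mul_polyC.
split=> [x|e oke].
  have span (j : bool) P : lspan ok (act c0 ('X, 0) (0, 1)) (if j then (0, P) else (P, 0)).
    have -> : (if j then (0, P) else (P, 0)) =
        \sum_(i < size (P \Po ('X - c0%:P)))
           act c0 ('X, 0) (0, 1) (P \Po ('X - c0%:P))`_i (val i, nat_of_bool j).
      under eq_bigr do rewrite actE ?okP ?leq_b1 //=.
      rewrite -{1 2}(comp_poly_shiftK P c0C) comp_polyE.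
      by case: j; rewrite /= ext_sumE /= big1_eq.
    by apply: lspan_sum => i; apply: lspan_gen; apply/okP; rewrite leq_b1.
  have -> : x = (x.1, 0) + (0, x.2) by rewrite ext_addE /= addr0 add0r; case: x.
  exact: lspan_add (span false _) (span true _).
exists (fun x : ext C => ((if e.2 == 0%N then x.1 else x.2) \Po ('X - c0%:P))`_e.1).
split=> [x y|r e' oke']; first by case: ifP => _; rewrite comp_polyD coefD.
rewrite actE //; move: oke oke' => /okP; case: e e' => [a j] [a' j'] /= j1 /okP /= j1'.
rewrite xpair_eqE.
case: j j1 => [|[|//]] _; case: j' j1' => [|[|//]] _;
  rewrite /= ?andbF ?comp_poly0 ?coef0 // comp_poly_shiftX // coefZ coefXn andbT eq_sym;
  by case: eqP; rewrite ?mulr1 ?mulr0.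
Qed.

(** With u = t odd, c0 + t occurs at most once, and replacing t by c0 + t is a triangular change of
    basis: the coordinate at exponent 0 is corrected by the t-part times c0. *)
Lemma ext_odd_basis (c0 : C) (ok : nat * nat -> Prop) :
  (forall ab, ok ab <-> (ab.1 <= 1)%N) -> lbasis ok (act c0 (0, 1) ('X, 0)).
Proof.
move=> okP.
have actE c ab : ok ab -> act c0 (0, 1) ('X, 0) c ab =
    if ab.1 == 0%N then (c *: 'X^(ab.2), 0) else ((c * c0) *: 'X^(ab.2), c *: 'X^(ab.2)).
  case: ab => a j /okP /= a1; rewrite /act ext_addE /= addr0 add0r ext_expE.
  case: a a1 => [|[|//]] _; rewrite ?expr0 ?expr1 ?mul1r !ext_mulE /= ?mulr0 ?mul0r ?addr0.
    by rewrite mul_polyC.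
  by rewrite add0r mul1r /sgp map_polyXn mulrA -polyCM !mul_polyC.
split=> [x|e oke].
  have span (P Q : {poly C}) i : lspan ok (act c0 (0, 1) ('X, 0)) (P`_i *: 'X^i, Q`_i *: 'X^i).
    have -> : (P`_i *: 'X^i, Q`_i *: 'X^i) =
        act c0 (0, 1) ('X, 0) (P`_i - Q`_i * c0) (0%N, i) + act c0 (0, 1) ('X, 0) Q`_i (1%N, i).
      by rewrite !actE ?okP //= ext_addE /= add0r -scalerDl subrK.
    by apply: lspan_add; apply: lspan_gen; apply/okP.
  pose n := maxn (size x.1) (size x.2).
  have big (P : {poly C}) : (size P <= n)%N -> P = \sum_(i < n) P`_i *: 'X^i.
    move=> Pn; apply/polyP=> i; rewrite -(poly_def n (fun i => P`_i)) coef_poly.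
    by case: ltnP => // ni; rewrite nth_default // (leq_trans Pn).
  have -> : x = \sum_(i < n) ((x.1)`_i *: 'X^i, (x.2)`_i *: 'X^i).
    by rewrite ext_sumE /= -!big ?leq_maxl ?leq_maxr //; case: x {span n big}.
  by apply: lspan_sum => i; apply: span.
exists (fun x : ext C => if e.1 == 0%N then x.1`_e.2 - x.2`_e.2 * c0 else x.2`_e.2).
split=> [x y|r e' oke'].
  by case: ifP => _; rewrite ext_addE /= !coefD ?mulrDl // opprD addrACA.
rewrite actE //; move: oke oke' => /okP; case: e e' => [a j] [a' j'] /= a1 /okP /= a1'.
rewrite xpair_eqE [in RHS]andbC.
case: a a1 => [|[|//]] _; case: a' a1' => [|[|//]] _;
  rewrite /= ?andbF ?andbT ?coef0 ?mul0r ?subr0 // !coefZ !coefXn (eq_sym j);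
  by case: eqP; rewrite ?mulr1 ?mulr0 ?mul0r ?subrr.
Qed.

End ExtBases.

(** * Acyclicity and basis of the extension by a contractible pair *)

Section ContractibleExtension.
Variables (k : fieldType) (C : dga k).
Hypothesis chark0 : [pchar k] =i pred0.

Section InOut.
Variables (b : bool) (p : int) (p_even : ~~ odd (absz p)).
Let C' := ext_dga C b p_even.

Definition ext_in (c : C) : C' := ((c%:P, 0) : ext C).
Definition ext_out (x : C') : C := (x : ext C).1`_0.

Lemma ext_in_morph : dga_morph ext_in.
Proof.
split=> [c a a'|a a'||n a ha|a].
- apply: (etrans _ (esym (ext_addE _ _))); congr pair; last first.
    by rewrite /= scaler0 add0r.
  by rewrite /= polyCD -mul_polyC -polyCM -scalerAl mul1r.
- apply: (etrans _ (esym (ext_mulE _ _))); congr pair; first by rewrite /= polyCM.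
  by rewrite /= mulr0 mul0r addr0.
- by [].
- move=> i /=; rewrite coefC coef0; split; last exact: dhom0.
  by case: i => [|i] /=; [rewrite subr0|apply: dhom0].
- congr pair.
    case: b; rewrite ?raddf0 ?mul0r ?addr0; apply/polyP=> i; rewrite coef_ddp !coefC;
    by case: ifP; rewrite ?raddf0.
  rewrite raddf0 add0r; case: b => //=; apply/polyP=> i.
  by rewrite coef0 coef_deriv coef_sgp coefC /= raddf0 mul0rn.
Qed.

Lemma ext_out_morph : dga_morph ext_out.
Proof.
split=> [c a a'|a a'||n a ha|a].
- by rewrite /ext_out [_ + _]ext_addE ext_scaleE /= coefD coefZ -scalerAl mul1r.
- by rewrite /ext_out [_ * _]ext_mulE /= coef0M.
- by rewrite /ext_out /= coef1.
- by have [h _] := ha 0%N; rewrite /= mulr0n subr0 in h.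
- rewrite /ext_out /= coefD coef_ddp; case: b; last by rewrite coef0 addr0.
  by rewrite coefMX addr0.
Qed.

Lemma ext_inK c : ext_out (ext_in c) = c.
Proof. by rewrite /ext_out /= coefC. Qed.

End InOut.

(** Let P + Q t be a cycle with P_0 = 0. If dt = X, then P = S X and sgn(S) t is a primitive. If dX
    = t, the sign-twisted antiderivative of Q is one; dividing by i + 1 uses characteristic 0. *)
Lemma ext_out_acyclic b p (p_even : ~~ odd (absz p)) :
  ker_acyclic (@ext_out b p p_even).
Proof.
move=> n x hx; rewrite /ext_out /= /ext_d; move: (x : ext C) hx => {x} [P Q] hx.
case: b hx => hx [].
  rewrite addr0 => dP dQ P0; pose S := drop_poly 1 P.
  have PE : P = S * 'X.
    by apply/polyP=> -[|i]; rewrite coefMX //= coef_drop_poly addn1.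
  have hS : ddp S = - sgp Q.
    apply/polyP=> i; have /polyP/(_ i.+1) := dP.
    rewrite coefD coefMX coef_ddp coef0 coefN /= coef_ddp coef_drop_poly addn1.
    by move/eqP; rewrite addr_eq0 => /eqP.
  exists ((0, sgp S) : ext C); split=> [i|].
    rewrite /= coef0 coef_sgp coef_drop_poly addn1; split; first exact: dhom0.
    have [h _] := hx i.+1; apply: dhom_eq (dhom_sgn h) _.
    by rewrite /= mulrS; lia.
  rewrite /= /ext_d /= raddf0 add0r addr0 sgpK -PE; congr pair.
  by rewrite ddp_sgp hS raddfN /= sgpK opprK.
rewrite addr0 => dP dQ P0.
have nz i : (i.+1%:R : k) != 0 by rewrite (pcharf0P k).1.
pose I (S : {poly C}) := \poly_(i < (size S).+1)
  (if i is j.+1 then (j.+1%:R^-1 : k) *: S`_j else 0).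
have coefI S i : (I S)`_i = if i is j.+1 then (j.+1%:R^-1 : k) *: S`_j else 0.
  rewrite coef_poly; case: i => [|i]; first by [].
  by rewrite ltnS; case: ltnP => // h; rewrite nth_default ?scaler0.
exists ((sgp (I Q), 0) : ext C); split=> [i|].
  rewrite /= coef0 coef_sgp coefI; split; last exact: dhom0.
  case: i => [|i]; first exact/dhom_sgn/dhom0.
  have [_ h] := hx i; apply: dhom_eq (dhom_sgn (dhomZ _ h)) _.
  by rewrite mulrS; lia.
rewrite /= /ext_d /= raddf0 add0r addr0 sgpK; congr pair; last first.
  apply/polyP=> i; rewrite coef_deriv coefI -scaler_nat scalerA divff ?scale1r //.
(* The cycle condition recovers P_(i+1) from d Q_i, and P_0 = 0 settles the constant term. *)
apply/polyP=> i; rewrite coef_ddp coef_sgp coefI.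
case: i => [|i]; first by rewrite !raddf0.
have /polyP/(_ i) := dQ; rewrite coefD coef_ddp coef_deriv coef_sgp coef0.
move/eqP; rewrite addr_eq0 => /eqP dQi.
rewrite dd_sgn linearZ /= dQi -scaler_nat scalerN raddfN opprK scalerA mulVf //.
by rewrite scale1r /= sgnK.
Qed.

(** The even member of the pair has to be the polynomial variable, so the parity of m decides
    between dX = t (u = t, v = X) and dt = X (u = X, v = t). The relation dv = u is recorded through
    [ker_acyclic p]. *)
Lemma adjoin_contractible_pair m (c0 : C) : dhom m c0 ->
  exists (C' : dga k) (i : C -> C') (p : C' -> C) (u v : C'),
    [/\ [/\ dga_morph i, dga_morph p, forall c, p (i c) = c & ker_acyclic p],
        [/\ dhom m u, dd u = 0, p u = 0 & dhom (m - 1) v] &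
        lbasis (fun ab : nat * nat => (odd (absz m) -> (ab.1 <= 1)%N) /\
                                      (odd (absz (m - 1)) -> (ab.2 <= 1)%N))
          (fun c ab => i c * ((i c0 + u) ^+ ab.1 * v ^+ ab.2))].
Proof.
move=> hc0; case: (boolP (odd (absz m))) => [m_odd|m_even].
  have p_even : ~~ odd (absz (m - 1)) by lia.
  exists (ext_dga C false p_even), (@ext_in _ _ _), (@ext_out _ _ _).
  exists ((0, 1) : ext C), (('X, 0) : ext C).
  split; [split| split |].
  - exact: ext_in_morph.
  - exact: ext_out_morph.
  - exact: ext_inK.
  - exact: ext_out_acyclic.
  - move=> i /=; rewrite coef0 coef1; split; first exact: dhom0.
    case: i => [|i]; last exact: dhom0.
    by apply: dhom_eq (dhom1 _) _; rewrite mulr0n; lia.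
  - rewrite /= /ext_d /= !raddf0 !addr0; congr pair.
    by apply/polyP=> i; rewrite coef_ddp coef1 coef0; case: i => [|i];
      rewrite /= ?dd1 ?raddf0.
  - by rewrite /ext_out /= coef0.
  - move=> i /=; rewrite coef0 coefX; split; last exact: dhom0.
    case: eqP => [->|_]; last exact: dhom0.
    by apply: dhom_eq (dhom1 _) _; rewrite mulr1n; lia.
  apply: ext_odd_basis => ab; split=> [[h _]|h]; first exact: h.
  by split=> // h'; move: h'; rewrite (negbTE p_even).
exists (ext_dga C true m_even), (@ext_in _ _ _), (@ext_out _ _ _).
exists (('X, 0) : ext C), ((0, 1) : ext C).
split; [split| split |].
- exact: ext_in_morph.
- exact: ext_out_morph.
- exact: ext_inK.
- exact: ext_out_acyclic.
- move=> i /=; rewrite coef0 coefX; split; last exact: dhom0.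
  case: eqP => [->|_]; last exact: dhom0.
  by apply: dhom_eq (dhom1 _) _; rewrite mulr1n; lia.
- rewrite /= /ext_d /= !raddf0 mul0r !addr0; congr pair.
  by apply/polyP=> i; rewrite coef_ddp coefX coef0; case: eqP; rewrite /= ?dd1 ?raddf0.
- by rewrite /ext_out /= coefX.
- move=> i /=; rewrite coef0 coef1; split; first exact: dhom0.
  case: i => [|i]; last exact: dhom0.
  by apply: dhom_eq (dhom1 _) _; rewrite mulr0n; lia.
apply: ext_even_basis => [r|ab].
  move: r; apply: graded_ind => [r r' h h'|n r hr]; first by rewrite mulrDl mulrDr h h'.
  by rewrite (graded_comm hr hc0) (negbTE m_even) andbF mul1r.
split=> [[_ h]|h]; first by apply: h; lia.
by split=> // h'; move: h'; rewrite (negbTE m_even).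
Qed.

End ContractibleExtension.

(** * Universal property of free graded-commutative algebras *)

Section Monomials.
Variables (k : fieldType).
Hypothesis chark0 : [pchar k] =i pred0.

Lemma odd_sqr (D : dga k) m (a : D) : dhom m a -> odd (absz m) -> a * a = 0.
Proof.
move=> ha om; have := graded_comm ha ha; rewrite om expr1 mulN1r => /eqP.
rewrite -addr_eq0 -mulr2n -scaler_nat scaler_eq0.
by rewrite (pcharf0P k).1 // => /eqP.
Qed.

Variables (n : nat) (dg : 'I_n -> int).
Implicit Types (e : {ffun 'I_n -> nat}) (r : seq 'I_n).

Definition mdeg e : int := \sum_i dg i *+ e i.

Definition incr e (i : 'I_n) : {ffun 'I_n -> nat} := [ffun j => (e j + (j == i))%N].

(** The Koszul sign for moving the i-th variable past the factors that precede it. It depends on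
    exponents and degrees alone, hence is the same in every algebra; this makes [free_graded_morph]
    multiplicative. *)
Fixpoint shuffle_sign e (i : 'I_n) r : bool :=
  if r is j :: r' then
    if j == i then false
    else (odd (absz (dg i)) && odd (absz (dg j *+ e j))) (+) shuffle_sign e i r'
  else false.

Section InDga.
Variables (D : dga k) (z : 'I_n -> D).
Hypothesis hz : forall i, dhom (dg i) (z i).

Lemma monom_hom e : dhom (mdeg e) (monom z e).
Proof.
rewrite /mdeg /monom; apply: (big_ind2 (@dhom k D)); first exact: dhom1.
  by move=> *; apply: dhomM.
by move=> i _; apply: dhomX.
Qed.

Lemma monom0 : monom z [ffun => 0%N] = 1.
Proof. by rewrite /monom big1 // => i _; rewrite ffunE. Qed.

Lemma mul_var_prod e i r : uniq r -> i \in r ->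
  z i * \prod_(j <- r) z j ^+ e j =
  (-1) ^+ shuffle_sign e i r * \prod_(j <- r) z j ^+ incr e i j.
Proof.
elim: r => // j r IH /= /andP[jr ur]; rewrite inE !big_cons ffunE.
case: (eqVneq j i) => [<- _|ji] /=.
  rewrite ?eqxx addn1 exprS mul1r -mulrA; congr (_ * (_ * _)).
  apply: eq_big_seq => l lr; rewrite ffunE.
  by case: (eqVneq l j) lr jr => [->->//|_ _ _]; rewrite addn0.
rewrite addn0 /= => ir; rewrite mulrA.
rewrite (graded_comm (hz i) (dhomX (e j) (hz j))) -mulrA -[in LHS](mulrA (z j ^+ _)) (IH ur ir).
by rewrite !mulr_sign; do 2!case: ifP => _; rewrite /= ?mulrN ?opprK.
Qed.

Lemma mul_var_monom e i :
  z i * monom z e = (-1) ^+ shuffle_sign e i (index_enum 'I_n) * monom z (incr e i).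
Proof. by apply: mul_var_prod; rewrite ?index_enum_uniq ?mem_index_enum. Qed.

Lemma monom_nadm e : ~ admissible dg e -> monom z e = 0.
Proof.
move=> nadm; have : [exists i, odd (absz (dg i)) && (1 < e i)%N].
  apply: contra_notT nadm; rewrite negb_exists => /forallP H i oi;
  by have := H i; rewrite oi /= -leqNgt.
case/existsP=> i /andP[oi]; case E: (e i) => [|[|m]] // _.
have : i \in index_enum 'I_n by rewrite mem_index_enum.
rewrite /monom; elim: (index_enum _) => // j r IH; rewrite inE big_cons.
case: eqVneq => [<- _|_ /IH ->]; last by rewrite mulr0.
by rewrite E !exprS mulrA (odd_sqr (hz i) oi) !mul0r.
Qed.

Lemma mul_varX_monom e i a : exists s : bool,
  z i ^+ a * monom z e =
    (-1) ^+ s * monom z [ffun j => if j == i then (e j + a)%N else e j].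
Proof.
elim: a => [|a [s IH]].
  exists false; rewrite !mul1r; congr monom; apply/ffunP=> j; rewrite ffunE addn0.
  by case: eqP.
rewrite exprS -mulrA IH !mulr_sign.
set e' := [ffun j => _] in IH *.
have -> : [ffun j => if j == i then (e j + a.+1)%N else e j] = incr e' i.
  apply/ffunP=> j; rewrite !ffunE; case: eqP => _; by rewrite ?addn0 // addn1 addnS.
exists (s (+) shuffle_sign e' i (index_enum 'I_n)).
have := mul_var_monom e' i; case: s {IH} => /=; rewrite ?mulrN => ->;
  by rewrite !mulr_sign; case: ifP; rewrite ?opprK.
Qed.

End InDga.

End Monomials.

Section FreeBases.
Variables (k : fieldType).

(** Compatibility with [dd] is left out because, during the induction, the map from A commutes with
    d only on the generators already treated. *)
Definition graded_morph (A B : dga k) (f : A -> B) : Prop :=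
  [/\ forall (c : k) (a b : A), f (c *: a + b) = c *: f a + f b,
      forall a b : A, f (a * b) = f a * f b,
      f 1 = 1
    & forall n (a : A), dhom n a -> dhom n (f a)].

Lemma dga_graded_morph (A B : dga k) (f : A -> B) : dga_morph f -> graded_morph f.
Proof. by case=> *; split. Qed.

Lemma semilinear_add (U V : lmodType k) (F : U -> V) :
  (forall c a b, F (c *: a + b) = c *: F a + F b) -> forall a b, F (a + b) = F a + F b.
Proof. by move=> H a b; rewrite -{1}[a]scale1r H scale1r. Qed.

Lemma semilinear_scale (U V : lmodType k) (F : U -> V) :
  (forall c a b, F (c *: a + b) = c *: F a + F b) -> forall c a, F (c *: a) = c *: F a.
Proof.
move=> H c a; rewrite -[c *: a]addr0 H.
have -> : F 0 = 0 by apply: (addrI (F 0)); rewrite -(semilinear_add H) !addr0.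
by rewrite addr0.
Qed.

Lemma lbasis_linear (V W : lmodType k) (E : eqType) (ok : E -> Prop) (v : E -> V) (w : E -> W) :
  lbasis ok (fun c e => c *: v e) ->
  exists F : V -> W, (forall c a b, F (c *: a + b) = c *: F a + F b) /\
    forall e, ok e -> F (v e) = w e.
Proof.
case=> span indep.
have [|||||F [Flin Fh]] := @linear_extension k V W (k * E)%type
    (fun p => ok p.2) (fun c p => (c * p.1, p.2))
    (fun p => p.1 *: v p.2) (fun p => p.1 *: w p.2).
- by [].
- by move=> c p; rewrite scalerA.
- by move=> c p; rewrite scalerA.
- exact: span.
- move=> l okl l0; rewrite (big_group snd) big_seq big1 // => e.
  rewrite mem_undup => /mapP[p pl ->]; have okp := okl p pl.
  have [co [coD coE]] := indep _ okp.
  rewrite (eq_bigr (fun q => q.1 *: w p.2)); last by move=> q /eqP->.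
  rewrite -scaler_suml.
  suff -> : \sum_(q <- l | q.2 == p.2) q.1 = 0 by rewrite scale0r.
  have := congr1 co l0; rewrite (semi_additive_sum _ _ _ coD) big_seq.
  under eq_bigr => q ql do rewrite (coE _ _ (okl q ql)).
  rewrite -big_seq -big_mkcond => ->.
  by apply: (addrI (co 0)); rewrite -coD !addr0.
exists F; split=> // e oke; have := Fh (1, e) oke; by rewrite /= !scale1r.
Qed.

Variables (n : nat) (dg : 'I_n -> int).

(** Independence, stated for duplicate-free lists of exponents, makes the coefficient at e0 well
    defined on formal sums once terms are grouped by exponent; [linear_extension] turns it into a
    functional. *)
Lemma free_over_lbasis (A : dga k) (x : 'I_n -> A) :
  free_over (fun c : k => c%:A : A) x dg ->
  lbasis (admissible dg) (fun c e => c *: monom x e).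
Proof.
case=> _ gen indep.
have span v : lspan (admissible dg) (fun c e => c *: monom x e) v.
  have [s [c [oks ->]]] := gen v.
  exists [seq (c e, e) | e <- s]; rewrite big_map; split=> [p /mapP[e es ->]|]; first exact: oks.
  by apply: eq_bigr => e _; rewrite mulr_algl.
split=> // e0 oke0.
have [|||||F [Flin Fh]] := @linear_extension k A k^o (k * {ffun 'I_n -> nat})%type
    (fun p => admissible dg p.2) (fun c p => (c * p.1, p.2))
    (fun p => p.1 *: monom x p.2) (fun p => if p.2 == e0 then p.1 else 0).
- by [].
- by move=> c p; rewrite scalerA.
- by move=> c p /=; case: ifP => _; rewrite ?scaler0.
- exact: span.
- move=> l okl l0; rewrite -big_mkcond.
  case e0l: (e0 \in undup (map snd l)); last first.
    rewrite big_seq_cond big1 // => p /andP[pl /eqP pe]; move: e0l.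
    by rewrite mem_undup -pe map_f.
  apply: (indep (undup (map snd l)) (fun e => \sum_(p <- l | p.2 == e) p.1)) e0l.
  + exact: undup_uniq.
  + by move=> e; rewrite mem_undup => /mapP[p pl ->]; apply: okl.
  + rewrite -[RHS]l0 (big_group snd); apply: eq_bigr => e _.
    rewrite mulr_algl scaler_suml; apply: eq_bigr => p /eqP -> //.
exists F; split; first exact: (semilinear_add Flin).
by move=> c e oke; rewrite (Fh (c, e)).
Qed.

Section WithBasis.
Variables (A : dga k) (x : 'I_n -> A).
Hypothesis (hx : forall i, dhom (dg i) (x i))
  (xbasis : lbasis (admissible dg) (fun c e => c *: monom x e)).

(** Projecting any expansion to degree m discards the monomials of other degrees. *)
Lemma homogeneous_span m (a : A) : dhom m a ->
  exists l : seq (k * {ffun 'I_n -> nat}),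
    (forall p, p \in l -> admissible dg p.2 /\ mdeg dg p.2 = m) /\
    a = \sum_(p <- l) p.1 *: monom x p.2.
Proof.
move=> ha; have [F [Flin Fh]] := homogeneous_part A m.
have [l [okl la]] := xbasis.1 a.
exists [seq p <- l | mdeg dg p.2 == m]; split.
  by move=> p; rewrite mem_filter => /andP[/eqP -> /okl].
have := Fh _ _ ha; rewrite eqxx => <-; rewrite la.
rewrite (semi_additive_sum _ _ _ (semilinear_add Flin)) big_filter [RHS]big_mkcond.
by apply: eq_bigr => p _; rewrite (Fh (mdeg dg p.2)) //; apply/dhomZ/monom_hom.
Qed.

Hypothesis chark0 : [pchar k] =i pred0.

Lemma free_graded_morph (D : dga k) (z : 'I_n -> D) : (forall i, dhom (dg i) (z i)) ->
  exists G : A -> D, graded_morph G /\ forall i, G (x i) = z i.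
Proof.
move=> hz; have [G [Glin Gm]] := lbasis_linear (monom z) xbasis.
(* The basis only gives admissible exponents; all other monomials vanish on both sides. *)
have GE e : G (monom x e) = monom z e.
  case: (boolP [forall i, odd (absz (dg i)) ==> (e i <= 1)%N]) => [/forallP H|H].
    by apply: Gm => i oi; have := H i; rewrite oi.
  have nadm : ~ admissible dg e by move=> ok; case/negP: H; apply/forallP=> i; apply/implyP/ok.
  rewrite (monom_nadm chark0 hx nadm) (monom_nadm chark0 hz nadm).
  by rewrite -(scale0r 0) (semilinear_scale Glin) scale0r.
(* [Q a b] says that G intertwines left multiplication by a and by b. It is closed under products
   and holds for generators because their signs agree, which yields multiplicativity. *)
pose Q (a : A) (b : D) := forall a', G (a * a') = b * G a'.
have QM a b a' b' : Q a b -> Q a' b' -> Q (a * a') (b * b').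
  by move=> H H' c; rewrite -!mulrA H H'.
have Q1 : Q 1 1 by move=> a; rewrite !mul1r.
have Qx i : Q (x i) (z i).
  move=> a; have [l [_ ->]] := xbasis.1 a.
  rewrite mulr_sumr !(semi_additive_sum _ _ _ (semilinear_add Glin)) mulr_sumr.
  apply: eq_bigr => p _; rewrite -scalerAr !(semilinear_scale Glin) GE -scalerAr.
  congr (_ *: _); rewrite (mul_var_monom hx) (mul_var_monom hz) !mulr_sign.
  by case: ifP => _; rewrite -?scaleN1r ?(semilinear_scale Glin) GE.
have Qm e : Q (monom x e) (monom z e).
  rewrite /monom; apply: (big_ind2 Q) => // i _.
  by elim: (e i) => // j IH; rewrite !exprS; apply: QM.
have QG a : Q a (G a).
  have [l [_ ->]] := xbasis.1 a; move=> a'.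
  rewrite mulr_suml !(semi_additive_sum _ _ _ (semilinear_add Glin)) mulr_suml.
  by apply: eq_bigr => p _; rewrite -scalerAl !(semilinear_scale Glin) Qm GE -scalerAl.
have G1 : G 1 = 1 by rewrite -(monom0 x) GE monom0.
exists G; split; last by move=> i; rewrite -[x i]mulr1 Qx G1 mulr1.
split=> // m a /homogeneous_span[l [okl ->]].
rewrite (semi_additive_sum _ _ _ (semilinear_add Glin)) big_seq; apply: dhom_sum => p /okl[_ <-].
by rewrite (semilinear_scale Glin) GE; apply/dhomZ/monom_hom.
Qed.

End WithBasis.

Lemma graded_morph_sgn (A D : dga k) (G : A -> D) a : graded_morph G -> G (sgn a) = sgn (G a).
Proof.
case=> Glin _ _ Gdeg; move: a; apply: graded_ind => [a b IH IH'|m a ha].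
  by rewrite !(raddfD, semilinear_add Glin) /= IH IH'.
rewrite (sgn_hom ha) (sgn_hom (Gdeg _ _ ha)) !mulr_sign.
by case: ifP; rewrite // -scaleN1r (semilinear_scale Glin) scaleN1r.
Qed.

Lemma graded_morph_monom (A D : dga k) (G : A -> D) (x : 'I_n -> A) e : graded_morph G ->
  G (monom x e) = monom (G \o x) e.
Proof.
case=> _ GM G1 _; rewrite /monom (big_morph G GM G1); apply: eq_bigr => i _ /=.
by elim: (e i) => [|j IH]; rewrite ?expr0 // !exprS GM IH.
Qed.

End FreeBases.

(** * Induction on the generators *)

(** As in the tower law for field extensions, expansions are substituted into one another and
    coordinates are composed. *)
Lemma lbasis_tower (E1 E2 : eqType) (R V W : zmodType) (ok1 : E1 -> Prop) (ok2 : E2 -> Prop)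
    (act1 : R -> E1 -> V) (act2 : V -> E2 -> W) :
  (forall e a b, act2 (a + b) e = act2 a e + act2 b e) ->
  lbasis ok1 act1 -> lbasis ok2 act2 ->
  lbasis (fun e : E1 * E2 => ok1 e.1 /\ ok2 e.2) (fun r e => act2 (act1 r e.1) e.2).
Proof.
move=> act2D [span1 ind1] [span2 ind2]; split=> [w|[e1 e2] [/= ok1e ok2e]].
  have [l [okl ->]] := span2 w; rewrite big_seq.
  apply: (big_ind (lspan _ _)); [exact: lspan0|exact: lspan_add|move=> [v e2] /okl /= ok2e].
  have [l' [okl' ->]] := span1 v; rewrite (semi_additive_sum _ _ _ (act2D e2)) big_seq.
  apply: (big_ind (lspan _ _)); [exact: lspan0|exact: lspan_add|move=> [r e1] /okl' /= ok1e].
  exact: (@lspan_gen _ _ _ _ _ r (e1, e2)).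
have [co1 [co1D co1E]] := ind1 _ ok1e; have [co2 [co2D co2E]] := ind2 _ ok2e.
exists (co1 \o co2); split=> [a b|r [e1' e2'] [/= ok1' ok2']]; first by rewrite /= co2D co1D.
rewrite co2E // xpair_eqE andbC; case: eqP => _; first exact: co1E.
by apply: (addrI (co1 0)); rewrite -co1D !addr0.
Qed.

(** The sign in the hypothesis accommodates reordering of graded-commutative factors, which changes
    each basis vector by at most a sign. *)
Lemma lbasis_reindex (E E' : eqType) (R : nzRingType) (V : zmodType)
    (ok : E -> Prop) (ok' : E' -> Prop) (act : R -> E -> V) (act' : R -> E' -> V)
    (phi : E' -> E) (psi : E -> E') :
  (forall e', ok' e' -> ok (phi e') /\ psi (phi e') = e') ->
  (forall e, ok e -> ok' (psi e) /\ phi (psi e) = e) ->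
  (forall e', ok' e' -> exists s : bool, forall r, act' r e' = act ((-1) ^+ s * r) (phi e')) ->
  lbasis ok act -> lbasis ok' act'.
Proof.
move=> okphi okpsi actE [span ind]; split=> [v|e' oke'].
  have [l [okl ->]] := span v; rewrite big_seq.
  apply: (big_ind (lspan _ _)); [exact: lspan0|exact: lspan_add|move=> [r e] /okl /= oke].
  have [oke' phie] := okpsi _ oke; have [s sE] := actE _ oke'.
  have <- : act' ((-1) ^+ s * r) (psi e) = act r e by rewrite sE phie mulrA -expr2 sqrr_sign mul1r.
  exact: lspan_gen.
have [okp pK] := okphi _ oke'; have [co [coD coE]] := ind _ okp.
have [s sE] := actE _ oke'; exists (fun v => (-1) ^+ s * co v).
split=> [a b|r e'' oke'']; first by rewrite coD mulrDr.
have [okp'' pK''] := okphi _ oke''; have [s' sE'] := actE _ oke''.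
rewrite sE' coE //; have -> : (phi e'' == phi e') = (e'' == e').
  by apply/eqP/eqP => [/(congr1 psi)|->//]; rewrite pK pK''.
case: eqP => [ee|_]; last by rewrite mulr0.
subst e''.
have := sE r; rewrite sE' => /(congr1 co); rewrite !coE // eqxx => ->.
by rewrite mulrA -expr2 sqrr_sign mul1r.
Qed.

Lemma lbasis_eq0 (k : fieldType) (V : lmodType k) (E : eqType) (ok : E -> Prop)
    (m : E -> V) (v : V) :
  lspan ok (fun c e => c *: m e) v ->
  (forall e, ok e -> exists co : V -> k, [/\ forall a b, co (a + b) = co a + co b,
    forall r e', ok e' -> co (r *: m e') = if e' == e then r else 0 & co v = 0]) ->
  v = 0.
Proof.
move=> [l [okl vE]] H; rewrite vE (big_group snd) big_seq big1 // => e.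
rewrite mem_undup => /mapP[p pl ->]; have [co [coD coE co0]] := H _ (okl p pl).
rewrite (eq_bigr (fun q => q.1 *: m p.2)); last by move=> q /eqP->.
rewrite -scaler_suml; suff -> : \sum_(q <- l | q.2 == p.2) q.1 = 0 by rewrite scale0r.
rewrite -[RHS]co0 vE (semi_additive_sum _ _ _ coD) big_mkcond.
by apply: eq_big_seq => q ql; rewrite coE //; apply: okl.
Qed.

Section Morphisms.
Variable k : fieldType.

Lemma semilinear_zero (U V : lmodType k) (F : U -> V) :
  (forall c a b, F (c *: a + b) = c *: F a + F b) -> F 0 = 0.
Proof. by move=> H; rewrite -(scale0r 0) (semilinear_scale H) scale0r. Qed.

Lemma semilinear_sub (U V : lmodType k) (F : U -> V) :
  (forall c a b, F (c *: a + b) = c *: F a + F b) -> forall a b, F (a - b) = F a - F b.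
Proof.
by move=> H a b; rewrite (semilinear_add H) -scaleN1r (semilinear_scale H) scaleN1r.
Qed.

Lemma dga_morph_comp (A B C : dga k) (f : A -> B) (g : B -> C) :
  dga_morph f -> dga_morph g -> dga_morph (g \o f).
Proof.
case=> flin fM f1 fdeg fdd [glin gM g1 gdeg gdd]; split=> /=.
- by move=> c a b; rewrite flin glin.
- by move=> a b; rewrite fM gM.
- by rewrite f1 g1.
- by move=> m a /fdeg/gdeg.
- by move=> a; rewrite fdd gdd.
Qed.

(** Split a as (a - io(p a)) + io(p a): the first term is a cycle in ker p, and p a is a cycle in
    ker h whose primitive is carried back by io. *)
Lemma ker_acyclic_comp (A B C : dga k) (p : A -> B) (io : B -> A) (h : B -> C) :
  dga_morph p -> dga_morph io -> (forall b, p (io b) = b) ->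
  ker_acyclic p -> ker_acyclic h -> ker_acyclic (h \o p).
Proof.
move=> [plin _ _ pdeg pdd] [iolin _ _ iodeg iodd] pio pac hac d a ha da ha0.
have [|c [hc dc]] := hac _ _ (pdeg _ _ ha) _ ha0.
  by rewrite -pdd da (semilinear_zero plin).
have [||c' [hc' dc']] := pac _ (a - io (p a)) (dhomB ha (iodeg _ _ (pdeg _ _ ha))).
- by rewrite raddfB /= -iodd -pdd da !(semilinear_zero plin, semilinear_zero iolin) subr0.
- by rewrite (semilinear_sub plin) pio subrr.
exists (c' + io c); split; first exact/dhomD/iodeg.
by rewrite raddfD /= dc' -iodd dc subrK.
Qed.

End Morphisms.

(** * The invariant of the induction and its propagation *)

Section Stages.
Variables (k : fieldType) (chark0 : [pchar k] =i pred0) (A B : dga k) (f : A -> B).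
Hypothesis hf : dga_morph f.
Variables (n : nat) (x : 'I_n -> A) (dg : 'I_n -> int).
Hypotheses (hx : forall i, dhom (dg i) (x i) /\ dg i <= 0)
  (xbasis : lbasis (admissible dg) (fun c e => c *: monom x e)).
Implicit Types P : {set 'I_n}.

Definition supported P (e : {ffun 'I_n -> nat}) := forall i, i \notin P -> e i = 0%N.

(** Generators outside P go to s(f x_i) and add nothing to the basis. For empty P the basis clause
    is freeness of B over k; for full P it yields freeness of C over A. *)
Definition stage P := exists (C : dga k) (s : B -> C) (h : C -> B) (G : A -> C)
    (N : nat) (w : 'I_N -> C) (dgw : 'I_N -> int),
  [/\ [/\ dga_morph s, dga_morph h, forall b, h (s b) = b & ker_acyclic h],
      [/\ graded_morph G, forall a, h (G a) = f a,
          forall i, i \in P -> dd (G (x i)) = G (dd (x i))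
        & forall i, i \notin P -> G (x i) = s (f (x i))],
      (forall i, dhom (dgw i) (w i) /\ dgw i <= 0)
    & lbasis (fun e : {ffun 'I_n -> nat} * {ffun 'I_N -> nat} =>
                [/\ admissible dg e.1, supported P e.1 & admissible dgw e.2])
             (fun c e => c *: (monom (G \o x) e.1 * monom w e.2))].

(** As degrees are nonpositive, a monomial containing x_i has degree at most that of x_i; for i
    outside P this is less than dg j + 1. *)
Lemma supported_span P j (a : A) : dhom (dg j + 1) a ->
    (forall l, l \notin P -> dg l <= dg j) ->
  exists l : seq (k * {ffun 'I_n -> nat}),
    (forall p, p \in l -> supported P p.2) /\ a = \sum_(p <- l) p.1 *: monom x p.2.
Proof.
move=> ha hP; have [l [okl ->]] := homogeneous_span (fun i => (hx i).1) xbasis ha.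
exists l; split=> // p /okl[_ degp] i /hP ij; apply/eqP/negPn/negP => pi.
have : mdeg dg p.2 <= dg i.
  rewrite /mdeg (bigD1 i) //= -[leRHS]addr0; apply: lerD.
    case: (p.2 i) pi => // m _; rewrite mulrS gerDl.
    by rewrite mulrn_wle0 // (hx i).2.
  by apply: sumr_le0 => l' _; rewrite mulrn_wle0 // (hx l').2.
by rewrite degp => /le_trans/(_ ij); lia.
Qed.

(** Both d G and G d are derivations along G, so agreement on the x_i with i in P extends to the
    subalgebra they generate. *)
Lemma graded_morph_dd P (C : dga k) (G : A -> C) (a : A)
    (l : seq (k * {ffun 'I_n -> nat})) :
  graded_morph G -> (forall i, i \in P -> dd (G (x i)) = G (dd (x i))) ->
  (forall p, p \in l -> supported P p.2) -> a = \sum_(p <- l) p.1 *: monom x p.2 ->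
  dd (G a) = G (dd a).
Proof.
move=> Gm GP okl ->; have [Glin GM G1 Gdeg] := Gm.
have GD := semilinear_add Glin; have GZ := semilinear_scale Glin.
have G0 : G 0 = 0 by apply: (addrI (G 0)); rewrite -GD !addr0.
rewrite (semi_additive_sum _ _ _ GD) !raddf_sum (semi_additive_sum _ _ _ GD) /=.
apply: eq_big_seq => p /okl supp; rewrite GZ !linearZ /= GZ; congr (_ *: _).
pose Q (b : A) := dd (G b) = G (dd b).
have Q1 : Q 1 by rewrite /Q G1 !dd1 G0.
have QM b c : Q b -> Q c -> Q (b * c).
  by rewrite /Q GM !dd_mul GD !GM -(graded_morph_sgn _ Gm) => -> ->.
rewrite -/(Q _) /monom; apply: (big_ind Q) => // i _.
case: (boolP (i \in P)) => [iP|/supp ->]; last by rewrite expr0.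
by elim: (p.2 i) => // j IH; rewrite exprS; apply: QM => //; apply: GP.
Qed.

Lemma monom_rcons (C : dga k) N (w : 'I_N -> C) (v : C) (e : {ffun 'I_N.+1 -> nat}) :
  monom (fun j => if unlift ord_max j is Some j' then w j' else v) e =
  monom w [ffun j => e (lift ord_max j)] * v ^+ e ord_max.
Proof.
have widenE (j : 'I_N) : widen_ord (leqnSn N) j = lift ord_max j.
  by apply: val_inj; rewrite /= /bump leqNgt ltn_ord.
rewrite /monom big_ord_recr /= unlift_none; congr (_ * _).
by apply: eq_bigr => j _; rewrite widenE liftK ffunE.
Qed.

Lemma graded_comm_sign (C : dga k) p q (a b : C) : dhom p a -> dhom q b ->
  exists s : bool, a * b = (-1) ^+ s * (b * a).
Proof. by move=> ha hb; exists (odd (absz p) && odd (absz q)); apply: graded_comm. Qed.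

Section AdjoinBasis.
Variables (P : {set 'I_n}) (i : 'I_n).
Hypothesis iP : i \notin P.
Variables (N : nat) (dgw : 'I_N -> int).

Let ok P N (dgw : 'I_N -> int) (e : {ffun 'I_n -> nat} * {ffun 'I_N -> nat}) :=
  [/\ admissible dg e.1, supported P e.1 & admissible dgw e.2].

(** The tower yields the products io(z^e w^e') z'_i^a v^b; up to sign, z'_i^a moves into its place
    among the z' and v becomes the last of the w. *)
Lemma adjoin_basis (C C' : dga k) (io : C -> C') (z : 'I_n -> C) (w : 'I_N -> C)
    (z' : 'I_n -> C') (v : C') :
  graded_morph io ->
  (forall j, dhom (dg j) (z' j)) -> (forall j, j \in P -> z' j = io (z j)) ->
  (forall j, dhom (dgw j) (w j)) ->
  lbasis (ok P dgw) (fun c e => c *: (monom z e.1 * monom w e.2)) ->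
  lbasis (fun ab : nat * nat => (odd (absz (dg i)) -> (ab.1 <= 1)%N) /\
                                (odd (absz (dg i - 1)) -> (ab.2 <= 1)%N))
    (fun c ab => io c * (z' i ^+ ab.1 * v ^+ ab.2)) ->
  lbasis
    (ok (i |: P) (fun j : 'I_N.+1 => if unlift ord_max j is Some j' then dgw j' else dg i - 1))
    (fun c e => c *: (monom z' e.1 *
       monom (fun j => if unlift ord_max j is Some j' then io (w j') else v) e.2)).
Proof.
move=> iom hz' z'E hw basisC basisC'.
have [iolin ioM io1 iodeg] := iom.
have ioD e a b : io (a + b) * (z' i ^+ e.1 * v ^+ e.2) =
    io a * (z' i ^+ e.1 * v ^+ e.2) + io b * (z' i ^+ e.1 * v ^+ e.2).
  by rewrite (semilinear_add iolin) mulrDl.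
have := lbasis_tower ioD basisC basisC'.
apply: (@lbasis_reindex _ _ _ _ _ _ _ _
  (fun e : {ffun 'I_n -> nat} * {ffun 'I_N.+1 -> nat} =>
     (([ffun j => if j == i then 0%N else e.1 j], [ffun j => e.2 (lift ord_max j)]),
      (e.1 i, e.2 ord_max)))
  (fun e : ({ffun 'I_n -> nat} * {ffun 'I_N -> nat}) * (nat * nat) =>
     ([ffun j => if j == i then e.2.1 else e.1.1 j],
      [ffun j => if unlift ord_max j is Some j' then e.1.2 j' else e.2.2]))).
- move=> [e1 e2] [/= adm1 supp adm2]; split.
    split; [split|split] => /=.
    + by move=> j oj; rewrite ffunE; case: ifP => // _; apply: adm1.
    + move=> j jP; rewrite ffunE; case: ifP => // ji; apply: supp.
      by rewrite in_setU1 ji.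
    + by move=> j oj; rewrite ffunE; apply: adm2; rewrite liftK.
    + exact: adm1.
    + by move=> o; apply: adm2; rewrite unlift_none.
  congr pair; apply/ffunP=> j; rewrite !ffunE; first by case: eqP => [->|].
  by case: unliftP => [j' ->|->]; rewrite ?ffunE.
- move=> [[e1 e2] [a b]] [[/= adm1 supp adm2] [adma admb]]; split.
    split=> /=.
    + by move=> j oj; rewrite ffunE; case: eqP oj => [-> /adma|_ /adm1].
    + move=> j; rewrite in_setU1 negb_or ffunE => /andP[/negbTE-> jP].
      exact: supp.
    + by move=> j; rewrite ffunE; case: unlift.
  congr pair; congr pair; rewrite ?ffunE ?eqxx ?unlift_none //; apply/ffunP=> j; rewrite !ffunE.
    by case: eqP => [->|//]; rewrite supp.
  by rewrite liftK.
move=> [e1 e2] [/= adm1 supp adm2].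
set e1' := [ffun j => _]; set e2' := [ffun j => _].
have [s1 E1] := mul_varX_monom hz' e1' i (e1 i).
have {}E1 : z' i ^+ e1 i * monom z' e1' = (-1) ^+ s1 * monom z' e1.
  rewrite E1; congr (_ * monom _ _); apply/ffunP=> j; rewrite !ffunE.
  by case: eqP => [->|].
have ioz : io (monom z e1') = monom z' e1'.
  rewrite (graded_morph_monom _ _ iom) /monom; apply: eq_bigr => j _ /=; rewrite ffunE.
  case: (eqVneq j i) => [_|ji]; first by rewrite !expr0.
  case: (boolP (j \in P)) => [/z'E -> //|jP]; rewrite supp ?expr0 //.
  by rewrite in_setU1 negb_or ji.
have hz1 := monom_hom hz' e1'.
(* The power of z'_i passes the w-monomial (s2), then the z'-monomial (s3), and is inserted at its
   index (s1). *)
have hiw := iodeg _ _ (monom_hom hw e2').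
have [s2 E2] := graded_comm_sign hiw (dhomX (e1 i) (hz' i)).
have [s3 E3] := graded_comm_sign hz1 (dhomX (e1 i) (hz' i)).
exists (s1 (+) s2 (+) s3) => r.
rewrite monom_rcons -/e2' (semilinear_scale iolin) ioM ioz.
have -> : monom (io \o w) e2' = io (monom w e2') by rewrite (graded_morph_monom _ _ iom).
set X := monom z' e1' in E1 E3 *; set Y := io (monom w e2') in E2 *.
set Z := z' i ^+ e1 i in E1 E2 E3 *; set V := v ^+ _.
rewrite -[RHS]scalerAl.
have -> : X * Y * (Z * V) = (-1) ^+ (s1 (+) s2 (+) s3) * (monom z' e1 * (Y * V)).
  have -> : X * Y * (Z * V) = X * (Y * Z) * V by rewrite !mulrA.
  have -> : X * (Y * Z) = (-1) ^+ s2 * (X * Z * Y).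
    by rewrite E2 !mulr_sign; case: ifP; rewrite ?mulrN mulrA.
  rewrite E3 E1 !mulr_sign.
  by case: s1 {E1}; case: s2 {E2}; case: s3 {E3}; rewrite /= ?mulNr ?opprK mulrA.
by case: (s1 (+) s2 (+) s3); rewrite /= ?expr1 ?expr0 ?mulN1r ?mul1r ?scaleNr ?scalerN ?opprK.
Qed.

End AdjoinBasis.

Lemma stage_step P i : stage P -> (forall j l, j \in P -> l \notin P -> dg l <= dg j) ->
  i \notin P -> (forall l, l \notin P -> dg l <= dg i) -> stage (i |: P).
Proof.
move=> [C [s [h [G [N [w [dgw [[sm hm hs hac] [Gm hG GP GnP] hw basis]]]]]]]] upper iP imax.
have [slin sM s1 sdeg sdd] := sm; have [hlin hM h1 hdeg hdd] := hm.
have [Glin GM G1 Gdeg] := Gm; have [flin _ _ fdeg fdd] := hf.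
have ddsupp j a : (forall l, l \notin P -> dg l <= dg j) -> dhom (dg j + 1) a ->
    dd (G a) = G (dd a).
  move=> jP ha; have [l [okl la]] := supported_span ha jP.
  exact: graded_morph_dd Gm GP okl la.
have hxi := (hx i).1; set base := s (f (x i)).
have hbase : dhom (dg i) base by apply/sdeg/fdeg.
have hGdd := Gdeg _ _ (dd_deg hxi).
have [||c [hc dc]] := hac _ _ (dhomB hGdd (dd_deg hbase)).
- by rewrite raddfB /= dd_dd subr0 (ddsupp i) ?dd_dd ?(semilinear_zero Glin) //; apply: dd_deg.
- by rewrite (semilinear_sub hlin) hG fdd /base -sdd hs subrr.
rewrite addrK in hc.
(* Subtracting s(h c) puts the correction in ker h without changing its differential, since d(h c) =
   h(dc) = 0. *)
pose c0 := base + (c - s (h c)).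
have hc0 : dhom (dg i) c0.
  by apply: (dhomD hbase); apply: (dhomB hc); apply/sdeg/hdeg.
have dc0 : dd c0 = G (dd (x i)).
  rewrite /c0 raddfD raddfB /= -sdd -hdd dc (semilinear_sub hlin) hG fdd /base -sdd hs.
  by rewrite subrr (semilinear_zero slin) subr0 addrC subrK.
have hc0E : h c0 = f (x i).
  by rewrite (semilinear_add hlin) (semilinear_sub hlin) !hs subrr addr0.
have [C' [io [p [u [v [[iom pm pio pac] [hu du pu hv] basis']]]]]] :=
  adjoin_contractible_pair chark0 hc0.
have [iolin ioM io1 iodeg iodd] := iom; have [plin pM p1 pdeg pdd] := pm.
(* Only the value at x_i changes; [free_graded_morph] extends these values to all of A. *)
pose z' j := if j == i then io c0 + u else io (G (x j)).
have hz' j : dhom (dg j) (z' j).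
  rewrite /z'; case: eqP => [->|_]; first exact: (dhomD (iodeg _ _ hc0) hu).
  by apply/iodeg/Gdeg; exact: (hx j).1.
have [G' [G'm G'x]] := free_graded_morph (fun j => (hx j).1) xbasis chark0 hz'.
have z'P j : j \in P -> z' j = io (G (x j)).
  by move=> jP; rewrite /z'; case: eqP jP iP => // -> ->.
have G'P (l : seq (k * {ffun 'I_n -> nat})) : (forall q, q \in l -> supported P q.2) ->
    G' (\sum_(q <- l) q.1 *: monom x q.2) = io (G (\sum_(q <- l) q.1 *: monom x q.2)).
  have [G'lin _ _ _] := G'm => okl.
  rewrite !(semi_additive_sum _ _ _ (semilinear_add Glin)).
  rewrite (semi_additive_sum _ _ _ (semilinear_add iolin)).
  rewrite (semi_additive_sum _ _ _ (semilinear_add G'lin)).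
  apply: eq_big_seq => q /okl supp.
  rewrite (semilinear_scale G'lin) (semilinear_scale Glin) (semilinear_scale iolin); congr (_ *: _).
  rewrite (graded_morph_monom _ _ G'm) (graded_morph_monom _ _ Gm).
  rewrite (graded_morph_monom _ _ (dga_graded_morph iom)) /monom; apply: eq_bigr => j _ /=.
  by rewrite G'x; case: (boolP (j \in P)) => [/z'P ->//|/supp ->].
(* The new map and io G agree on d x_j, which involves only generators in P, where their values
   coincide. *)
have G'dd j : (forall l, l \notin P -> dg l <= dg j) -> G' (dd (x j)) = io (G (dd (x j))).
  move=> jP; have [l [okl ->]] := supported_span (dd_deg (hx j).1) jP.
  exact: G'P.
exists C', (io \o s), (h \o p), G', N.+1,
  (fun j => if unlift ord_max j is Some j' then io (w j') else v),
  (fun j => if unlift ord_max j is Some j' then dgw j' else dg i - 1).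
split.
- split.
  + exact: dga_morph_comp.
  + exact: dga_morph_comp.
  + by move=> b /=; rewrite pio hs.
  + exact: (ker_acyclic_comp pm iom pio).
- split=> //.
  + have [G'lin G'M G'1 _] := G'm.
    move=> a; have [l [_ ->]] := xbasis.1 a => /=.
    rewrite !(semi_additive_sum _ _ _ (semilinear_add G'lin)).
    rewrite (semi_additive_sum _ _ _ (semilinear_add plin)).
    rewrite (semi_additive_sum _ _ _ (semilinear_add hlin)).
    rewrite (semi_additive_sum _ _ _ (semilinear_add flin)).
    apply: eq_bigr => q _; rewrite (semilinear_scale G'lin) (semilinear_scale plin).
    rewrite (semilinear_scale hlin) (semilinear_scale flin); congr (_ *: _).
    rewrite (graded_morph_monom _ _ G'm) (graded_morph_monom _ _ (dga_graded_morph pm)).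
    rewrite (graded_morph_monom _ _ (dga_graded_morph hm)).
    rewrite (graded_morph_monom _ _ (dga_graded_morph hf)) /monom.
    apply: eq_bigr => j _ /=; rewrite G'x /z'; case: eqP => [->|_]; last by rewrite pio hG.
    by rewrite (semilinear_add plin) pio pu addr0 hc0E.
  + move=> j; rewrite in_setU1 G'x => /orP[/eqP->|jP].
      by rewrite /z' eqxx raddfD /= du addr0 -iodd dc0 G'dd.
    by rewrite z'P // -iodd GP // G'dd // => l; apply: upper.
  + move=> j; rewrite in_setU1 negb_or => /andP[/negbTE ji jP].
    by rewrite G'x /z' ji GnP.
- move=> j; case: unlift => [j'|]; last by split=> //; have := (hx i).2; lia.
  by have [h1' h2'] := hw j'; split=> //; apply: iodeg.
have G'xE : G' \o x =1 z' by move=> j; rewrite /= G'x.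
have := adjoin_basis iP (dga_graded_morph iom) hz' z'P (fun j => (hw j).1) basis.
move=> /(_ v); rewrite {1}/z' eqxx => /(_ basis').
have monomE e : monom (G' \o x) e = monom z' e.
  by rewrite /monom; apply: eq_bigr => j _; rewrite G'xE.
case=> span ind; split=> [b|e oke].
  have [l [okl ->]] := span b; exists l; split=> //.
  by apply: eq_bigr => q _; rewrite monomE.
have [co [coD coE]] := ind e oke; exists co; split=> // r e' oke'.
by rewrite monomE coE.
Qed.

(** Adding a generator of maximal degree among the remaining ones keeps P closed upwards in degree,
    as [stage_step] requires. *)
Lemma stage_all P : (forall j l, j \in P -> l \notin P -> dg l <= dg j) ->
  stage P -> stage [set: 'I_n].
Proof.
have [m] := ubnP #|~: P|; elim: m P => // m IH P Pm upper st.
case: (pickP (fun i => i \notin P)) => [i0 i0P|noP]; last first.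
  by have <- : P = [set: 'I_n] by apply/setP=> i; rewrite inE; have /negbFE := noP i.
case: (Order.TotalTheory.arg_maxP (P := fun i => i \notin P) dg i0P) => i iP imax.
apply: (IH (i |: P)); last exact: stage_step.
  rewrite -ltnS; apply: leq_trans Pm; rewrite ltnS proper_card //.
  by rewrite properC properUr // sub1set.
move=> j l; rewrite !in_setU1 negb_or => /orP[/eqP->|jP] /andP[_ lP]; first exact: imax.
exact: upper.
Qed.

Lemma stage0 N (y : 'I_N -> B) (dgy : 'I_N -> int) :
  (forall i, dhom (dgy i) (y i) /\ dgy i <= 0) ->
  lbasis (admissible dgy) (fun c e => c *: monom y e) -> stage set0.
Proof.
move=> hy ybasis; exists B, id, id, f, N, y, dgy; split=> //.
- split=> //.
  by move=> d b _ _ ->; exists 0; split; [apply: dhom0|rewrite raddf0].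
- split=> //; first exact: dga_graded_morph.
  by move=> i; rewrite in_set0.
apply: (lbasis_reindex (phi := snd) (psi := fun e => ([ffun => 0%N], e))) ybasis.
- move=> [e1 e2] [/= _ supp adm]; split=> //; congr pair; apply/ffunP=> i.
  by rewrite ffunE supp // in_set0.
- by move=> e adm; split=> //; split=> //= i; rewrite ffunE.
move=> [e1 e2] [/= _ supp _]; exists false => r; rewrite mul1r.
have -> : e1 = [ffun => 0%N] by apply/ffunP=> i; rewrite ffunE supp // in_set0.
by rewrite monom0 mul1r.
Qed.

End Stages.

(** To see that a coefficient c(e2) in A vanishes, its k-coordinates suffice: the one at e1 is the
    (e1, e2)-coordinate of the whole sum, which is 0. *)
Lemma free_over_stage (k : fieldType) (A C : dga k) (G : A -> C) n (x : 'I_n -> A)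
    (dg : 'I_n -> int) N (w : 'I_N -> C) (dgw : 'I_N -> int) :
  graded_morph G -> lbasis (admissible dg) (fun c e => c *: monom x e) ->
  (forall i, dhom (dgw i) (w i) /\ dgw i <= 0) ->
  lbasis (fun e : {ffun 'I_n -> nat} * {ffun 'I_N -> nat} =>
            admissible dg e.1 /\ admissible dgw e.2)
         (fun c e => c *: (monom (G \o x) e.1 * monom w e.2)) ->
  free_over G w dgw.
Proof.
move=> Gm xbasis hw [span ind]; have [Glin GM G1 Gdeg] := Gm.
have GD := semilinear_add Glin; split=> // [b|s c us oks s0 e2 e2s].
  have [l [okl ->]] := span b.
  exists (undup (map (fun p => p.2.2) l)),
    (fun e2 => \sum_(p <- l | p.2.2 == e2) p.1 *: monom x p.2.1); split.
    by move=> e2; rewrite mem_undup => /mapP[p /okl[_ ok2] ->].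
  rewrite (big_group (fun p => p.2.2)); apply: eq_bigr => e2 _.
  rewrite (semi_additive_sum _ _ _ GD) mulr_suml; apply: eq_bigr => p /eqP <-.
  by rewrite (semilinear_scale Glin) (graded_morph_monom _ _ Gm) -scalerAl.
apply: (lbasis_eq0 (xbasis.1 (c e2))) => e1 ok1.
have [coA [coAD coAE]] := xbasis.2 e1 ok1.
have [co [coD coE]] := ind (e1, e2) (conj ok1 (oks _ e2s)).
have coG a e2' : e2' \in s -> co (G a * monom w e2') = if e2' == e2 then coA a else 0.
  move=> /oks ok2; have [l [okl ->]] := xbasis.1 a.
  rewrite (semi_additive_sum _ _ _ GD) mulr_suml.
  rewrite (semi_additive_sum _ _ _ coD) (semi_additive_sum _ _ _ coAD).
  transitivity (\sum_(p <- l) if e2' == e2 then coA (p.1 *: monom x p.2) else 0); last first.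
    by case: ifP => // _; rewrite big1_eq.
  apply: eq_big_seq => p /okl okp.
  rewrite (semilinear_scale Glin) (graded_morph_monom _ _ Gm) -scalerAl.
  rewrite (coE p.1 (p.2, e2')) // coAE // xpair_eqE andbC.
  by case: (e2' == e2).
exists coA; split=> //.
have /(congr1 co) := s0; rewrite (semi_additive_sum _ _ _ coD).
rewrite (eq_big_seq (fun e => if e == e2 then coA (c e2) else 0)); last first.
  by move=> e es; rewrite coG //; case: eqP => // ->.
rewrite -big_mkcond -big_filter filter_pred1_uniq // big_seq1 => ->.
by apply: (addrI (co 0)); rewrite -coD !addr0.
Qed.

Theorem theorem5p3 (k : fieldType) (chark0 : [pchar k] =i pred0)
    (A B : dga k) (f : A -> B) :
  dga_morph f -> finite_resolving_alg A -> finite_resolving_alg B ->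
  exists (B' : dga k) (g : A -> B') (h : B' -> B),
    [/\ dga_morph g, dga_morph h, finite_resolving g, quasi_iso h
      & forall a : A, h (g a) = f a].
Proof.
move=> hf [n [x [dg xfree]]] [N0 [y [dgy yfree]]].
have xbasis := free_over_lbasis xfree; have [hx _ _] := xfree.
have ybasis := free_over_lbasis yfree; have [hy _ _] := yfree.
have /(stage_all chark0 hf hx xbasis) := stage0 hf x dg hy ybasis.
case=> [j l|C [s [h [G [N [w [dgw [[sm hm hs hac] [Gm hG GT _] hw basis]]]]]]]].
  by rewrite in_set0.
exists C, G, h; split=> //.
- have [Glin GM G1 Gdeg] := Gm; split=> // a.
  have [l [_ la]] := xbasis.1 a; apply/esym/(graded_morph_dd Gm GT _ la) => p _ i.
  by rewrite in_setT.
- exists N, w, dgw; apply: (free_over_stage Gm xbasis hw).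
  apply: (lbasis_reindex (phi := id) (psi := id)) basis.
  + by move=> e [ok1 ok2]; split=> //; split=> // i; rewrite in_setT.
  + by move=> e [ok1 _ ok2].
  + by move=> e _; exists false => r; rewrite mul1r.
have [slin sM s1 sdeg sdd] := sm; have [hlin hM h1 hdeg hdd] := hm.
split=> [m b hb db|m a ha da [c [hc hac']]].
  exists (s b); split; [exact: sdeg|by rewrite -sdd db (semilinear_zero slin)|].
  by exists 0; split; [apply: dhom0|rewrite hs subrr raddf0].
(* When h a = dc, the element a - s(dc) is a cycle in ker h; its primitive plus s c is a primitive
   of a. *)
have [|||a' [ha' da']] := hac m (a - s (dd c)).
- by apply: (dhomB ha); apply: sdeg; rewrite -hac'; apply: hdeg.
- by rewrite raddfB /= -sdd dd_dd da (semilinear_zero slin) subr0.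
- by rewrite (semilinear_sub hlin) hs hac' subrr.
exists (a' + s c); split; first exact/dhomD/sdeg.
by rewrite raddfD /= da' -sdd subrK.
Qed.
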